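(* Fix $p\in(1,+\infty)$ and a real number $\alpha>0$, and consider $T_\alpha\colon L^p[0,1]\to L^p[0,1]$. (i) If $\alpha\ge 1$, then $\sigma(T_\alpha)=\{0\}$ and $\sigma_0(T_\alpha)=\emptyset$. (ii) If $\alpha<1$, then $$\sigma(T_\alpha)=\sigma_0(T_\alpha)\cup\{0\},\qquad \sigma_0(T_\alpha)=\{\alpha^n(1-\alpha)\colon n\in\mathbb{N}\},$$ and for every $n\in\mathbb{N}$ the eigenspace associated with $\alpha^n(1-\alpha)$ is generated by a function $f_n(x)=x^{\frac{\alpha}{1-\alpha}}P_{n,\alpha}(\log x)$, where $P_{n,\alpha}$ is a suitable polynomial of degree $n$ depending on $\alpha$. The span of the family $\{f_n\}_{n\in\mathbb{N}}$ is dense in $L^p[0,1]$.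
   Context: $L^p[0,1]$ is taken over $\mathbb{C}$. For real $\alpha>0$, $T_\alpha$ is the bounded linear operator $(T_\alpha f)(x):=\int_0^{x^\alpha} f(y)\,dy$ on $L^p[0,1]$. $\sigma(T)$ denotes the spectrum of $T$ and $\sigma_0(T)$ its point spectrum, i.e. the set of eigenvalues. $\mathbb{N}=\{0,1,2,\dots\}$. *)

(* Defs.v *)
From HB Require Import structures.
From mathcomp Require Import all_boot all_order all_algebra generic_quotient.
From mathcomp Require Import ring_quotient.
From mathcomp Require Import complex.
From mathcomp Require Import all_classical all_reals all_analysis.
From mathcomp Require Import measurable_realfun.

Set Implicit Arguments.
Unset Strict Implicit.
Unset Printing Implicit Defensive.

Import Order.TTheory GRing.Theory Num.Theory.
Import numFieldNormedType.Exports.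
Import ComplexField.Normc.

Local Open Scope classical_set_scope.
Local Open Scope complex_scope.
Local Open Scope ring_scope.

Section complex_Lp.
Context d (T : measurableType d) (R : realType).
Variables (mu : {measure set T -> \bar R}) (p : R).
Local Notation C := R[i].

Definition cmeasurable (f : T -> C) :=
  measurable_fun setT (fun x => complex.Re (f x)) /\
  measurable_fun setT (fun x => complex.Im (f x)).

(* [normc] is the modulus as an element of R; the library norm of R[i] takes
   its values in R[i]. *)
Definition cLfun_prop (f : T -> C) :=
  cmeasurable f /\ finite_norm mu p%:E (fun x => normc (f x)).

Definition cLfun : {pred T -> C^o} := fun f => `[< cLfun_prop f >].

Lemma normc_ge_normRe (z : C) : `|complex.Re z| <= normc z.
Proof. by rewrite -lecR; exact: normc_ge_Re. Qed.

Lemma normc_ge_normIm (z : C) : `|complex.Im z| <= normc z.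
Proof.
by case: z => a b /=; rewrite -sqrtr_sqr ler_wsqrtr// lerDr sqr_ge0.
Qed.

Lemma normc_le_normReIm (z : C) :
  normc z <= `|complex.Re z| + `|complex.Im z|.
Proof.
case: z => a b /=; rewrite -[leRHS]ger0_norm ?addr_ge0// -sqrtr_sqr.
rewrite ler_wsqrtr// sqrrD !real_normK ?num_real// lerD2r lerDl.
by rewrite mulrn_wge0// mulr_ge0.
Qed.

Lemma normc_ge0 (z : C) : 0 <= normc z.
Proof. by case: z => a b /=; exact: sqrtr_ge0. Qed.

Lemma measurable_normc (f : T -> C) :
  cmeasurable f -> measurable_fun setT (fun x => normc (f x)).
Proof.
move=> [mr mi].
have -> : (fun x => normc (f x)) =
    (fun x => (complex.Re (f x) ^+ 2 + complex.Im (f x) ^+ 2) `^ 2^-1).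
  apply/funext => x; case: (f x) => a b /=.
  by rewrite powR12_sqrt// addr_ge0 ?sqr_ge0.
apply: (@measurableT_comp _ _ _ _ _ _ (@powR R ^~ 2^-1)) => //.
by apply: measurable_funD; exact: measurable_funX.
Qed.

Lemma Lnorm_le (f g : T -> R) : 0 < p ->
  measurable_fun setT f -> measurable_fun setT g ->
  (forall x, `|f x| <= `|g x|) ->
  ('N[mu]_p%:E[EFin \o f] <= 'N[mu]_p%:E[EFin \o g])%E.
Proof.
move=> p0 mf mg fg; rewrite unlock /Lnorm.
apply: gt0_ler_poweR.
- by rewrite invr_ge0 ltW.
- by rewrite in_itv/= leey andbT integral_ge0.
- by rewrite in_itv/= leey andbT integral_ge0.
- apply: ge0_le_integral => //=.
  + apply/measurable_EFinP; apply: (@measurableT_comp _ _ _ _ _ _ (@powR R ^~ p)) => //.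
    exact: measurableT_comp.
  + apply/measurable_EFinP; apply: (@measurableT_comp _ _ _ _ _ _ (@powR R ^~ p)) => //.
    exact: measurableT_comp.
  + by move=> x _; rewrite lee_fin ge0_ler_powR// ?nnegrE// ltW.
Qed.

Hypothesis p1 : 1 <= p.
Let p1E : (1 <= p%:E)%E. Proof. by rewrite lee_fin. Qed.
Let p0 : 0 < p. Proof. exact: lt_le_trans p1. Qed.

Lemma LfunE (f : T -> R) : (f \in Lfun mu p%:E) <->
  measurable_fun setT f /\ finite_norm mu p%:E f.
Proof.
split; first by rewrite inE => /andP[/set_mem mf /set_mem].
by move=> [mf ff]; apply/andP; split; apply/mem_set.
Qed.

Lemma cLfunP (f : T -> C) : cLfun_prop f <->
  (fun x => complex.Re (f x)) \in Lfun mu p%:E /\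
  (fun x => complex.Im (f x)) \in Lfun mu p%:E.
Proof.
split.
- move=> [[mr mi] ff]; have mn := measurable_normc (conj mr mi).
  split; apply/LfunE; split=> //; apply: le_lt_trans ff; apply: Lnorm_le => // x.
  + by rewrite [leRHS]ger0_norm ?normc_ge0 ?normc_ge_normRe.
  + by rewrite [leRHS]ger0_norm ?normc_ge0 ?normc_ge_normIm.
- move=> [/LfunE[mr fr] /LfunE[mi fi]]; split=> //.
  pose u x : R := `|complex.Re (f x)|; pose v x : R := `|complex.Im (f x)|.
  have mu' : measurable_fun setT u by exact: measurableT_comp.
  have mv : measurable_fun setT v by exact: measurableT_comp.
  have h : ('N[mu]_p%:E[EFin \o (u \+ v)%R] < +oo)%E.
    apply: (le_lt_trans (minkowski_EFin mu mu' mv p1)).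
    apply: lte_add_pinfty.
      by apply: le_lt_trans fr; apply: Lnorm_le => // x; rewrite normr_id.
    by apply: le_lt_trans fi; apply: Lnorm_le => // x; rewrite normr_id.
  apply: le_lt_trans h.
  apply: Lnorm_le => //; [exact: measurable_normc|exact: measurable_funD|].
  move=> x; rewrite ger0_norm ?normc_ge0// ger0_norm ?addr_ge0 ?/u ?/v//.
  exact: normc_le_normReIm.
Qed.

Lemma cReM (a b : C) : complex.Re (a * b) =
  complex.Re a * complex.Re b - complex.Im a * complex.Im b.
Proof. by case: a; case: b. Qed.

Lemma cImM (a b : C) : complex.Im (a * b) =
  complex.Re a * complex.Im b + complex.Im a * complex.Re b.
Proof. by case: a; case: b. Qed.

Lemma cReD (a b : C) : complex.Re (a + b) = complex.Re a + complex.Re b.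
Proof. by case: a; case: b. Qed.

Lemma cImD (a b : C) : complex.Im (a + b) = complex.Im a + complex.Im b.
Proof. by case: a; case: b. Qed.

Lemma cLfun_submod_closed : submod_closed cLfun.
Proof.
have L0 := Lfun_submod_closed mu p1E.
have LZ : forall a (g : T -> R), g \in Lfun mu p%:E ->
    (fun x => a * g x) \in Lfun mu p%:E.
  by move=> a g gL; rewrite -[X in X \in _]addr0 (L0.2 a g 0 gL L0.1).
have LD : forall f g : T -> R, f \in Lfun mu p%:E -> g \in Lfun mu p%:E ->
    (fun x => f x + g x) \in Lfun mu p%:E.
  by move=> f g fL gL; have := L0.2 1 f g fL gL; rewrite scale1r.
split; first by apply/asboolP/cLfunP; split; exact: L0.1.
move=> a f g /asboolP/cLfunP[fr fi] /asboolP/cLfunP[gr gi].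
apply/asboolP/cLfunP; split.
- rewrite [X in X \in _](_ : _ = (fun x => (complex.Re a * complex.Re (f x) +
      (- complex.Im a) * complex.Im (f x)) + complex.Re (g x))).
    by apply: (LD) => //; apply: (LD); exact: LZ.
  apply/funext => x; rewrite /= mulNr -cReM.
  by rewrite -cReD.
- rewrite [X in X \in _](_ : _ = (fun x => (complex.Re a * complex.Im (f x) +
      complex.Im a * complex.Re (f x)) + complex.Im (g x))).
    by apply: (LD) => //; apply: (LD); exact: LZ.
  apply/funext => x; rewrite /= -cImM.
  by rewrite -cImD.
Qed.

End complex_Lp.


Record cLfunType d (T : measurableType d) (R : realType)
    (mu : {measure set T -> \bar R}) (p : R) (p1 : 1 <= p) := CLfun {
  clfun :> T -> R[i]^o ;
  clfunP : clfun \in cLfun mu p }.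

Section cLfunType_lmodule.
Context d (T : measurableType d) (R : realType).
Variables (mu : {measure set T -> \bar R}) (p : R) (p1 : 1 <= p).
Local Notation C := R[i].
Local Notation Lp := (cLfunType mu p1).

HB.instance Definition _ := [isSub for @clfun d T R mu p p1].
HB.instance Definition _ := [Choice of Lp by <:].
HB.instance Definition _ := GRing.isSubmodClosed.Build _ _ (cLfun mu p)
  (cLfun_submod_closed mu p1).
HB.instance Definition _ := [SubChoice_isSubLmodule of Lp by <:].

Definition null_cLfun : {pred Lp} := fun f => `[< (f : T -> C) = cst 0 %[ae mu] >].

Lemma null_cLfun_zmod_closed : zmod_closed null_cLfun.
Proof.
split; first by apply/asboolP; exact: aeW.
move=> f g /asboolP f0 /asboolP g0; apply/asboolP.
apply: filterS2 f0 g0 => x fx gx _.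
by rewrite -[LHS]/(f x - g x) fx// gx// subrr.
Qed.

HB.instance Definition _ := GRing.isZmodClosed.Build Lp null_cLfun
  null_cLfun_zmod_closed.

End cLfunType_lmodule.

(* L^p(mu; C): p-integrable complex functions modulo a.e. equality. As in the
   textbook construction, the quotient is taken by the submodule of a.e. null
   functions; see cLspace_eqP. *)
Definition cLspace d (T : measurableType d) (R : realType)
    (mu : {measure set T -> \bar R}) (p : R) (p1 : 1 <= p) : Type :=
  Quotient.quot (@null_cLfun d T R mu p p1).

Section cLspace_lmodule.
Context d (T : measurableType d) (R : realType).
Variables (mu : {measure set T -> \bar R}) (p : R) (p1 : 1 <= p).
Local Notation C := R[i].
Local Notation Lp := (cLfunType mu p1).
Local Notation LP := (cLspace mu p1).
Local Open Scope quotient_scope.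

HB.instance Definition _ := GRing.Zmodule.on LP.
HB.instance Definition _ := EqQuotient.on LP.

(* A representative of the class F. *)
Definition cLspace_fun (F : LP) : T -> C := repr F : Lp.

Lemma cLspace_eqP (f g : Lp) :
  \pi_LP f = \pi_LP g <-> (f : T -> C) = g %[ae mu].
Proof.
split=> [/eqP|fg].
  rewrite -Quotient.idealrBE => /asboolP; apply: filterS => x h /h.
  by move=> /eqP; rewrite -[X in X == _]/(f x - g x) subr_eq0 => /eqP.
apply/eqP; rewrite -Quotient.idealrBE; apply/asboolP.
by apply: filterS fg => x /[apply] fg; rewrite -[LHS]/(f x - g x) fg subrr.
Qed.

Definition cLscale (a : C) (F : LP) : LP := \pi_LP (a *: (repr F : Lp)).

Lemma pi_cLscale a (f : Lp) : cLscale a (\pi_LP f) = \pi_LP (a *: f).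
Proof.
apply/cLspace_eqP.
have : \pi_LP (repr (\pi_LP f) : Lp) = \pi_LP f by rewrite reprK.
move/cLspace_eqP; apply: filterS => x /[apply] h.
exact: (congr1 ( *%R a) h).
Qed.

Lemma cLscaleA a b F : cLscale a (cLscale b F) = cLscale (a * b) F.
Proof. by rewrite -[F]reprK (pi_cLscale b) 2!pi_cLscale scalerA. Qed.

Lemma cLscale1 : left_id 1 cLscale.
Proof. by move=> F; rewrite -[F]reprK !pi_cLscale scale1r. Qed.

Lemma pi_cLD (f g : Lp) : \pi_LP (f + g) = \pi_LP f + \pi_LP g.
Proof. by rewrite !piE. Qed.

Lemma cLscaleDr : right_distributive cLscale +%R.
Proof.
by move=> a F G; rewrite -[F]reprK -[G]reprK -pi_cLD !pi_cLscale scalerDr pi_cLD.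
Qed.

Lemma cLscaleDl F : {morph cLscale^~ F : a b / a + b}.
Proof.
by move=> a b; rewrite -[F]reprK !pi_cLscale scalerDl pi_cLD.
Qed.

HB.instance Definition _ := GRing.Zmodule_isLmodule.Build C LP
  cLscaleA cLscale1 cLscaleDr cLscaleDl.

Lemma pi_cLZ a (f : Lp) : \pi_LP (a *: f) = a *: \pi_LP f.
Proof. by rewrite -pi_cLscale. Qed.

End cLspace_lmodule.

Section cLspace_norm.
Context d (T : measurableType d) (R : realType).
Variables (mu : {measure set T -> \bar R}) (p : R) (p1 : 1 <= p).
Local Notation C := R[i].
Local Notation Lp := (cLfunType mu p1).
Local Notation LP := (cLspace mu p1).
Local Open Scope quotient_scope.
Let p0 : 0 < p. Proof. exact: lt_le_trans p1. Qed.

Lemma cLfun_measurable (f : Lp) : cmeasurable f.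
Proof. by have /asboolP[] := clfunP f. Qed.

Lemma cLfun_finite (f : Lp) : finite_norm mu p%:E (fun x => normc (f x)).
Proof. by have /asboolP[] := clfunP f. Qed.

Definition Lpnorm (f : T -> C) : R := fine 'N[mu]_p%:E[EFin \o (fun x => normc (f x))]%E.

Lemma Lpnorm_fineK (f : Lp) :
  (Lpnorm f)%:E = 'N[mu]_p%:E[EFin \o (fun x => normc (f x))]%E.
Proof.
rewrite fineK// fin_numElt (lt_le_trans ltNy0) ?Lnorm_ge0//=.
exact: cLfun_finite.
Qed.

Lemma ae_eq_Lpnorm (f g : Lp) : (f : T -> C) = g %[ae mu] ->
  Lpnorm f = Lpnorm g.
Proof.
move=> fg; rewrite /Lpnorm unlock /Lnorm.
have m (h : Lp) : measurable_fun setT (fun x => `|(normc (h x))%:E| `^ p)%E.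
  apply/measurable_EFinP; apply: (@measurableT_comp _ _ _ _ _ _ (@powR R ^~ p)) => //.
  by apply: measurableT_comp => //; apply/measurable_normc/cLfun_measurable.
suff -> : (\int[mu]_x (`|(normc (f x))%:E| `^ p) =
           \int[mu]_x (`|(normc (g x))%:E| `^ p))%E by [].
apply: ae_eq_integral => //.
apply: (filterS _ fg) => x /[apply] h.
by rewrite h.
Qed.

Definition cLnorm (F : LP) : C := (Lpnorm (cLspace_fun F))%:C.

Lemma pi_cLnorm (f : Lp) : cLnorm (\pi_LP f) = (Lpnorm f)%:C.
Proof.
congr (_%:C); apply: ae_eq_Lpnorm.
by apply/cLspace_eqP; rewrite reprK.
Qed.

Lemma Lpnorm_ge0 (f : T -> C) : 0 <= Lpnorm f.
Proof. by rewrite /Lpnorm fine_ge0// Lnorm_ge0. Qed.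

Lemma cLnormD F G : cLnorm (F + G) <= cLnorm F + cLnorm G.
Proof.
rewrite -[F]reprK -[G]reprK -pi_cLD !pi_cLnorm -rmorphD lecR.
move: (repr F) (repr G) => f g.
have mf := measurable_normc (cLfun_measurable f).
have mg := measurable_normc (cLfun_measurable g).
have mfg := measurable_normc (cLfun_measurable (f + g)).
rewrite -lee_fin EFinD !Lpnorm_fineK.
apply: le_trans (minkowski_EFin mu mf mg p1).
apply: Lnorm_le => //; first exact: measurable_funD.
move=> x; rewrite ger0_norm ?normc_ge0// ger0_norm ?addr_ge0 ?normc_ge0//.
exact: le_normcD.
Qed.

Lemma cLnormZ a F : cLnorm (a *: F) = `|a| * cLnorm F.
Proof.
rewrite -[F]reprK -pi_cLZ !pi_cLnorm.
have -> : `|a| = (normc a)%:C by case: a.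
rewrite -rmorphM; congr (_%:C); move: (repr F) => f.
apply: EFin_inj; rewrite EFinM !Lpnorm_fineK unlock /Lnorm.
have mf : measurable_fun setT (fun x => `|(normc (f x))%:E| `^ p)%E.
  apply/measurable_EFinP; apply: (@measurableT_comp _ _ _ _ _ _ (@powR R ^~ p)) => //.
  by apply: measurableT_comp => //; apply/measurable_normc/cLfun_measurable.
have -> : (\int[mu]_x (`|(EFin \o (fun x => normc ((a *: f) x))) x| `^ p) =
  (normc a `^ p)%:E * \int[mu]_x (`|(EFin \o (fun x => normc (f x))) x| `^ p))%E.
  rewrite -ge0_integralZl_EFin//; last 2 first.
  - by move=> x _; exact: poweR_ge0.
  - exact: powR_ge0.
  apply: eq_integral => x _.
  transitivity (`|(normc a * normc (f x))%:E| `^ p)%E.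
    by rewrite -normcM.
  by rewrite /= normrM (ger0_norm (normc_ge0 a)) powRM ?normc_ge0.
rewrite poweRM ?lee_fin ?powR_ge0//; last first.
  by apply: integral_ge0 => x _; exact: poweR_ge0.
by rewrite poweR_EFin -powRrM mulfV ?gt_eqF// powRr1 ?normc_ge0.
Qed.

Lemma cLnorm_eq0 F : cLnorm F = 0 -> F = 0.
Proof.
rewrite -[F]reprK pi_cLnorm => /complexI h.
have -> : 0 = \pi_LP (0 : Lp) by rewrite piE.
apply/cLspace_eqP; move: (repr F) h => f h.
have m : measurable_fun setT (EFin \o (fun x => normc (f x))).
  exact/measurable_EFinP/measurable_normc/cLfun_measurable.
have : ('N[mu]_p%:E[EFin \o (fun x => normc (f x))] = 0)%E.
  by rewrite -Lpnorm_fineK h.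
move=> /(Lnorm_eq0_eq0 m); rewrite lte_fin => /(_ p0).
by apply: filterS => x /[apply] -[] /eq0_normc.
Qed.

HB.instance Definition _ := Lmodule_isNormed.Build C LP
  cLnormD cLnormZ cLnorm_eq0.

End cLspace_norm.

Section spectrum.
Context (K : numFieldType) (V : normedModType K).

Definition bounded_op (S : V -> V) := exists M : K, forall v, `|S v| <= M * `|v|.

Definition resolvent_set (A : {linear V -> V}) : set K :=
  [set l | exists S : {linear V -> V}, [/\ bounded_op S,
     cancel (fun v => A v - l *: v) S & cancel S (fun v => A v - l *: v)]].

Definition spectrum (A : {linear V -> V}) : set K := ~` resolvent_set A.

Definition op_eigenspace (A : {linear V -> V}) (l : K) : set V :=
  [set v | A v = l *: v].

Definition point_spectrum (A : {linear V -> V}) : set K :=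
  [set l | exists2 v, v != 0 & op_eigenspace A l v].

Definition lin_span (X : set V) : set V :=
  [set v | exists (n : nat) (a : 'I_n -> K) (x : 'I_n -> V),
     (forall i, X (x i)) /\ v = \sum_(i < n) a i *: x i].

End spectrum.

Section mu01.
Variable R : realType.

Lemma lebesgue_itv01_lty :
  ((@lebesgue_measure R) (`[0%R, 1%R]%classic : set (measurableTypeR R)) < +oo)%E.
Proof. by rewrite lebesgue_measure_itv/= lte01 oppr0 adde0 ltry. Qed.

Lemma measurable_itv01 :
  measurable (`[0%R, 1%R]%classic : set (measurableTypeR R)).
Proof. exact: measurable_itv. Qed.

(* Lebesgue measure on [0, 1], as a measure on R: functions on R modulo
   mu01-a.e. equality are functions on [0, 1] modulo a.e. equality, so that
   cLspace (mu01 R) p1 is L^p[0, 1] over C. *)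
Definition mu01 : set (measurableTypeR R) -> \bar R :=
  mfrestr measurable_itv01 lebesgue_itv01_lty.

HB.instance Definition _ := FiniteMeasure.on mu01.

End mu01.
Arguments mu01 : clear implicits.

Definition cRintegral d (T : measurableType d) (R : realType)
    (mu : {measure set T -> \bar R}) (D : set T) (f : T -> R[i]) : R[i] :=
  (\int[mu]_(y in D) complex.Re (f y)) +i* (\int[mu]_(y in D) complex.Im (f y)).

Section cRintegral.
Context d (T : measurableType d) (R : realType).
Variables (mu : {measure set T -> \bar R}) (D : set T) (mD : measurable D).
Implicit Types f g : T -> R[i].

Definition cintegrable f :=
  mu.-integrable setT (EFin \o (fun x => complex.Re (f x))) /\
  mu.-integrable setT (EFin \o (fun x => complex.Im (f x))).

Lemma ae_eq_cRintegral f g : cintegrable f -> cintegrable g ->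
  f = g %[ae mu] -> cRintegral mu D f = cRintegral mu D g.
Proof.
move=> [fr fi] [gr gi] fg.
have main (u v : T -> R) : mu.-integrable setT (EFin \o u) ->
   mu.-integrable setT (EFin \o v) -> u = v %[ae mu] ->
   \int[mu]_(y in D) u y = \int[mu]_(y in D) v y.
  move=> iu iv uv; congr fine; apply: ae_eq_integral => //.
  - by have /integrableP[+ _] := integrableS measurableT mD (@subsetT _ _) iu.
  - by have /integrableP[+ _] := integrableS measurableT mD (@subsetT _ _) iv.
  - by apply: filterS uv => y /(_ I) h _; congr EFin.
by congr (_ +i* _); apply: main => //; apply: filterS fg => y h /h ->.
Qed.

Lemma cRintegral_linear a f g : cintegrable f -> cintegrable g ->
  cRintegral mu D (fun x => a * f x + g x) =
  a * cRintegral mu D f + cRintegral mu D g.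
Proof.
move=> [fr fi] [gr gi].
have I (u : T -> R) : mu.-integrable setT (EFin \o u) ->
    mu.-integrable D (EFin \o u) by exact: (integrableS measurableT).
have IZ k (u : T -> R) : mu.-integrable setT (EFin \o u) ->
    mu.-integrable setT (EFin \o (fun x => k * u x)) by exact: integrableZl.
have ID (u v : T -> R) : mu.-integrable setT (EFin \o u) ->
   mu.-integrable setT (EFin \o v) ->
    mu.-integrable setT (EFin \o (fun x => u x + v x)) by exact: integrableD.
have main k l (u v w : T -> R) : mu.-integrable setT (EFin \o u) ->
  mu.-integrable setT (EFin \o v) -> mu.-integrable setT (EFin \o w) ->
  \int[mu]_(y in D) (k * u y + l * v y + w y) =
  k * \int[mu]_(y in D) u y + l * \int[mu]_(y in D) v y + \int[mu]_(y in D) w y.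
  move=> iu iv iw.
  rewrite RintegralD//; [|by apply/I/ID; exact: IZ|exact: I].
  rewrite RintegralD//; [|by apply/I/IZ|by apply/I/IZ].
  by rewrite !RintegralZl//; exact: I.
apply/eqP; rewrite eq_complex cReD cImD cReM cImM /=; apply/andP; split; apply/eqP.
- rewrite -mulNr -main//; apply: eq_Rintegral => x _.
  by rewrite cReD cReM mulNr.
- rewrite -main//; apply: eq_Rintegral => x _.
  by rewrite cImD cImM.
Qed.

End cRintegral.

Section volterra.
Variables (R : realType) (alpha : R).
Local Notation C := R[i].
Local Notation mu01 := (mu01 R).
Implicit Types g : R -> R.

(* For x in [0, 1] the interval [0, x ^ alpha] is contained in [0, 1], hence
   integrating against mu01 is integrating against Lebesgue measure. Values at
   x outside [0, 1] are irrelevant, this set being mu01-negligible. *)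
Definition volterra_fun (f : R -> C) (x : R) : C :=
  cRintegral mu01 `[0, x `^ alpha] f.

Lemma measurable_primitive01 g : mu01.-integrable setT (EFin \o g) ->
  measurable_fun setT (fun t : R => \int[mu01]_(y in `[0, t]) g y).
Proof.
move=> ig.
have ge0_case (h : R -> R) : mu01.-integrable setT (EFin \o h) -> (forall x, 0 <= h x) ->
    measurable_fun setT (fun t : R => \int[mu01]_(y in `[0, t]) h y).
  move=> ih h0; apply: nondecreasing_measurable => // s t st.
  have mst u : measurable (`[0, u]%classic : set (measurableTypeR R)) by [].
  have fin (u : R) : (\int[mu01]_(y in `[0%R, u]) (h y)%:E)%E \is a fin_num.
    by apply: integrable_fin_num => //; apply: integrableS ih.
  rewrite fine_le//; apply: ge0_subset_integral => //.
  - by have /integrableP[+ _] := integrableS measurableT (mst t) (@subsetT _ _) ih.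
  - by move=> x _; rewrite lee_fin.
  - by move=> x /=; rewrite !in_itv/= => /andP[-> /le_trans ->].
have in_ : mu01.-integrable setT (EFin \o (fun x => `|g x|)).
  exact: (integrable_abse ig).
have id_ : mu01.-integrable setT (EFin \o (fun x => `|g x| - g x)).
  exact: (integrableB measurableT in_ ig).
rewrite (_ : (fun t : R => _) = (fun t : R => \int[mu01]_(y in `[0, t]) `|g y| -
     \int[mu01]_(y in `[0, t]) (`|g y| - g y))).
  apply: measurable_funB; apply: ge0_case => // x.
  by rewrite subr_ge0 ler_norm.
apply/funext => t; rewrite -RintegralB//.
- by apply: eq_Rintegral => x _; rewrite opprB addrC subrK.
- exact: (integrableS measurableT).
- exact: (integrableS measurableT).
Qed.

Lemma primitive01_le g t : mu01.-integrable setT (EFin \o g) ->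
  `|\int[mu01]_(y in `[0, t]) g y| <= \int[mu01]_y `|g y|.
Proof.
move=> ig.
have igt : mu01.-integrable `[0, t] (EFin \o g) by exact: (integrableS measurableT).
apply: (le_trans (le_normr_Rintegral _ igt)) => //.
rewrite fine_le//.
- by apply: integrable_fin_num => //; exact: (integrable_abse igt).
- by apply: integrable_fin_num => //; exact: (integrable_abse ig).
- apply: ge0_subset_integral => //.
  by have /integrableP[+ _] := integrable_abse ig.
Qed.

Lemma cLfun_integrable p (p1 : 1 <= p) (f : cLfunType mu01 p1) :
  cintegrable mu01 f.
Proof.
have /asboolP/(cLfunP _ p1)[fr fi] := clfunP f.
have p1E : (1 <= p%:E)%E by rewrite lee_fin.
have sub := @Lfun_subset _ _ _ mu01 1%E p%:E (lexx _) p1E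
  (fin_num_measure mu01 _ measurableT) p1E.
by split; apply/Lfun1_integrable; exact: sub.
Qed.

Lemma volterra_cLfun p (p1 : 1 <= p) (f : cLfunType mu01 p1) :
  volterra_fun f \in cLfun mu01 p.
Proof.
have [fr fi] := cLfun_integrable f.
have main g : mu01.-integrable setT (EFin \o g) ->
    (fun x => \int[mu01]_(y in `[0, x `^ alpha]) g y) \in Lfun mu01 p%:E.
  move=> ig; apply/LfunE.
  have mp : measurable_fun setT (fun x : measurableTypeR R => (x : R) `^ alpha).
    exact: measurable_powR.
  have m : measurable_fun setT (fun x : measurableTypeR R =>
      \int[mu01]_(y in `[0, (x : R) `^ alpha]) g y).
    exact: (measurableT_comp (measurable_primitive01 ig) mp).
  split=> //.
  have /LfunE[mc fc] := @Lfun_cst _ _ _ mu01 (\int[mu01]_y `|g y|) p.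
  apply: le_lt_trans fc; apply: Lnorm_le => //; first exact: (lt_le_trans ltr01 p1).
  move=> x; rewrite /= [leRHS]ger0_norm; first exact: primitive01_le.
  by apply: Rintegral_ge0.
by apply/asboolP/(cLfunP _ p1); split; exact: main.
Qed.

Variables (p : R) (p1 : 1 <= p).
Local Notation Lp := (cLfunType mu01 p1).
Local Notation LP := (cLspace mu01 p1).
Local Open Scope quotient_scope.

Definition volterra_Lfun (f : Lp) : Lp := CLfun p1 (volterra_cLfun f).

(* Independent of the representative by pi_volterra. *)
Definition volterra (F : LP) : LP := \pi_LP (volterra_Lfun (repr F)).

Lemma ae_eq_volterra_fun (f g : Lp) : (f : R -> C) = g %[ae mu01] ->
  volterra_fun f =1 volterra_fun g.
Proof.
move=> fg x.
have [[fr fi] [gr gi]] := (cLfun_integrable f, cLfun_integrable g).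
exact: ae_eq_cRintegral.
Qed.

Lemma pi_volterra (f : Lp) : volterra (\pi_LP f) = \pi_LP (volterra_Lfun f).
Proof.
apply/cLspace_eqP; apply: aeW => x _; apply: ae_eq_volterra_fun.
by apply/cLspace_eqP; rewrite reprK.
Qed.

Lemma volterra_is_linear : linear volterra.
Proof.
move=> a F G; rewrite -[F]reprK -[G]reprK.
rewrite -pi_cLZ -pi_cLD !pi_volterra -pi_cLZ -pi_cLD.
congr (\pi_LP _); apply: val_inj; apply/funext => x.
move: (repr F) (repr G) => f g.
exact: cRintegral_linear (cLfun_integrable f) (cLfun_integrable g).
Qed.

HB.instance Definition _ := GRing.isLinear.Build C LP LP _ volterra volterra_is_linear.

Lemma mu01_setT : mu01 setT = 1%E.
Proof.
rewrite /mu01 /mfrestr /mrestr setTI lebesgue_measure_itv/= lte01.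
by rewrite oppr0 adde0.
Qed.

Lemma Lnorm1_le_Lnorm : exists2 M : R, 0 <= M &
  forall g : R -> R, measurable_fun (setT : set (measurableTypeR R)) g ->
  ('N[mu01]_1[EFin \o g] <= M%:E * 'N[mu01]_p%:E[EFin \o g])%E.
Proof.
have := p1; rewrite le_eqVlt => /predU1P[<-|p_gt1].
  by exists 1 => // g mg; rewrite mul1e.
have pp : 0 < p by rewrite (lt_trans ltr01).
pose q := (1 - p^-1)^-1.
have q0 : 0 < q by rewrite invr_gt0 subr_gt0 invf_lt1.
have /LfunE[m1 f1] := @Lfun_cst _ _ _ mu01 (1:R) q.
exists (fine 'N[mu01]_q%:E[EFin \o (fun=> 1%R)]%E); first by rewrite fine_ge0// Lnorm_ge0.
move=> g mg; rewrite fineK ?ge0_fin_numE ?Lnorm_ge0//.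
have := @hoelder _ _ _ mu01 g (cst 1) p q mg m1 pp q0.
rewrite invrK addrC subrK => /(_ erefl).
rewrite muleC; congr (_ <= _)%E; congr (Lnorm _ _ _).
by apply/funext => x /=; rewrite mulr1.
Qed.

Lemma volterra_bounded : bounded_op volterra.
Proof.
have [M M0 HM] := Lnorm1_le_Lnorm.
exists ((M + M)%:C) => F; rewrite -[F]reprK pi_volterra.
move: (repr F) => f.
have -> : `|\pi_LP (volterra_Lfun f)| = (Lpnorm mu01 p (volterra_Lfun f))%:C.
  exact: pi_cLnorm.
have -> : `|\pi_LP f| = (Lpnorm mu01 p f)%:C by exact: pi_cLnorm.
rewrite -rmorphM lecR -lee_fin EFinM !Lpnorm_fineK.
have pp : 0 < p by rewrite (lt_le_trans ltr01).
have [fr fi] := cLfun_integrable f.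
have mf := measurable_normc (cLfun_measurable f).
pose c := \int[mu01]_y `|complex.Re (f y)| + \int[mu01]_y `|complex.Im (f y)|.
have c0 : 0 <= c by rewrite addr_ge0// Rintegral_ge0.
have step1 : ('N[mu01]_p%:E[EFin \o (fun x => normc (volterra_Lfun f x))] <= c%:E)%E.
  apply: (@le_trans _ _ 'N[mu01]_p%:E[EFin \o (fun=> c)]%E).
    apply: Lnorm_le => //; first exact/measurable_normc/cLfun_measurable.
    move=> x; rewrite ger0_norm ?normc_ge0// ger0_norm//.
    apply: (le_trans (normc_le_normReIm _)).
    by apply: lerD; exact: primitive01_le.
  rewrite unlock /Lnorm; under eq_integral do rewrite /= ger0_norm//.
  rewrite integral_cst//= mu01_setT mule1.
  by rewrite poweR_EFin -powRrM mulfV ?gt_eqF// powRr1.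
have step2 (g : R -> R) : mu01.-integrable setT (EFin \o g) ->
    (forall x, `|g x| <= normc (f x)) ->
    ((\int[mu01]_y `|g y|)%:E <= M%:E * 'N[mu01]_p%:E[EFin \o (fun x => normc (f x))])%E.
  move=> ig gf; apply: le_trans (HM _ mf).
  rewrite Lnorm1 fineK; last first.
    by apply: integrable_fin_num => //; exact: (integrable_abse ig).
  apply: ge0_le_integral => //.
  - by have /integrableP[+ _] := integrable_abse ig.
  - by apply/measurable_EFinP; exact: measurableT_comp.
  - by move=> x _; rewrite /= lee_fin (le_trans (gf x))// ler_norm.
apply: (le_trans step1).
rewrite (EFinD M M) ge0_muleDl ?lee_fin// /c EFinD.
by apply: leeD; apply: step2 => // x; [exact: normc_ge_normRe|exact: normc_ge_normIm].
Qed.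

End volterra.

Arguments volterra {R} alpha {p} p1 _.

(* Main.v *)
Require Import Defs.
From HB Require Import structures.
From mathcomp Require Import all_boot all_order all_algebra.
From mathcomp Require Import complex.
From mathcomp Require Import all_classical all_reals all_analysis.
From mathcomp Require Import ring lra measurable_realfun.

Set Implicit Arguments.
Unset Strict Implicit.
Unset Printing Implicit Defensive.

Import Order.TTheory GRing.Theory Num.Theory.
Import numFieldNormedType.Exports.
Import ComplexField.Normc.

Local Open Scope classical_set_scope.
Local Open Scope complex_scope.
Local Open Scope ring_scope.

(** Write [T f x] for the integral of [f] over [0, x ^ alpha].

    If [1 <= alpha], then [x ^ alpha <= x] on [0, 1] and the iterates of [T] are
    dominated by those of the classical Volterra operator, whose [n]-th power
    decreases like [1 / n!]. The Neumann series of [T / l] therefore converges for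
    every [l != 0] (kint_neumann), and only 0 is left for the spectrum. The value 0
    does belong to it, because [T] divides the size of [x ^ n] by at least [n + 1],
    and it is not an eigenvalue, because an integrable function whose primitive
    vanishes is null almost everywhere (primitive01_eq0).

    If [alpha < 1], the same argument applies to the operator [U] that integrates
    over [x ^ alpha, 1], with powers of [1 - x] instead of powers of [x]. Now
    [T f = (int_0^1 f) 1 - U f] is a rank-one perturbation of [- U], so that for
    [l != 0] the eigenspace is at most a line (rank_one_eigenvectors) and [l]
    belongs to the resolvent set unless it is an eigenvalue (rank_one_resolvent).
    Eigenfunctions are explicit: with [beta = alpha / (1 - alpha)], the equation
    [T f = l f] for [f = x ^ beta P(ln x)] is a recursion on the coefficients of [P]
    that stops at degree [n] for [l = alpha ^ n (1 - alpha)] (eigfunE).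

    That there is no other nonzero eigenvalue follows from the density of the span
    of these eigenfunctions. If [l] is none of the eigenvalues above, then the range
    of [T - l] contains all the eigenfunctions and is dense; but if [l] is an
    eigenvalue, then this range lies in the kernel of a nonzero continuous linear
    form (rank_one_dense_inj).

    For the density (dense_eigfun), a triangular argument on degrees shows that the
    closed span contains [x ^ beta q(ln x)] for every polynomial [q]. Expanding
    [x ^ c = exp (c ln x)] into its series, it contains [x ^ (beta + c j)] for all
    [c > 0] and all natural numbers [j], hence [x ^ beta r(x ^ c)] for every
    polynomial [r]. The polynomials [(1 - y ^ n) ^ (2 ^ n)] tend on [0, 1] to the
    indicator of [y < 1/2], almost everywhere; taken at [y = x ^ c] they give
    [x ^ beta] times the indicator of [x < a] for every [a]. The pi-lambda theorem
    and simple functions then give [x ^ beta h] for all [h], that is, every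
    function of the space. *)

(** * Resolvents and rank-one perturbations *)

Section operators.
Context (K : numFieldType) (V : normedModType K).
Implicit Types (A U : {linear V -> V}) (l : K) (v : V).

Lemma resolvent_intro A l (M : K) :
  (forall v, A v = l *: v -> v = 0) ->
  (forall v, exists2 g, A g - l *: g = v & `|g| <= M * `|v|) ->
  resolvent_set A l.
Proof.
move=> inj surj.
pose S v := sval (cid2 (surj v)).
have SE v : A (S v) - l *: S v = v by rewrite /S; case: cid2.
have Sb v : `|S v| <= M * `|v| by rewrite /S; case: cid2.
have uniq g h : A g - l *: g = A h - l *: h -> g = h.
  move=> gh; apply/eqP; rewrite -subr_eq0; apply/eqP/inj.
  apply/eqP; rewrite -subr_eq0; apply/eqP.
  have -> : A (g - h) - l *: (g - h) = (A g - l *: g) - (A h - l *: h).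
    by rewrite linearB scalerBr opprD addrACA -opprD.
  by rewrite gh subrr.
have Slin : linear S.
  move=> a u v; apply: uniq; rewrite SE linearP scalerDr opprD addrACA SE.
  by rewrite scalerA mulrC -scalerA -scalerBr SE.
pose SL : {linear V -> V} := HB.pack S (GRing.isLinear.Build K V V *:%R S Slin).
exists SL; split; first by exists M.
- by move=> v; apply: uniq; rewrite SE.
- exact: SE.
Qed.

(** Approximate eigenvectors at 0 prevent a bounded inverse: it would have to
    stretch [A (f n)] by the arbitrarily large factors [(c n)^-1]. *)
Lemma not_resolvent0 A (f : nat -> V) (c : nat -> K) :
  (forall n, f n != 0) -> (forall n, `|A (f n)| <= c n * `|f n|) ->
  (forall e, 0 < e -> exists n, c n < e) -> ~ resolvent_set A 0.
Proof.
move=> f0 Af c0 [S [[M SM] cS _]].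
have key n : `|f n| <= M * `|A (f n)|.
  by have := SM (A (f n)); rewrite -[A _ in X in X -> _](subr0) -(scale0r (f n)) cS scale0r subr0.
have M0 : 0 < M.
  have fp : 0 < `|f 0%N| by rewrite normr_gt0.
  have := key 0%N; have := normr_ge0 (A (f 0%N)).
  rewrite le_eqVlt => /predU1P[<-|Ap]; first by rewrite mulr0 normr_le0 (negPf (f0 0%N)).
  by move=> h; rewrite -(pmulr_lgt0 _ Ap) (lt_le_trans fp).
have [n cn] := c0 M^-1 (ltac:(by rewrite invr_gt0)).
have fp : 0 < `|f n| by rewrite normr_gt0.
have : `|f n| < `|f n|; last by rewrite ltxx.
apply: (le_lt_trans (key n)).
apply: (@le_lt_trans _ _ (M * (c n * `|f n|))); first by rewrite ler_pM2l.
by rewrite mulrA gtr_pMl// mulrC -ltr_pdivlMr// mul1r.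
Qed.

(** From here on [A] is the rank-one perturbation [phi (.) e] of [- U], and
    [U + l] has a bounded inverse. In terms of [v], the equation
    [A v - l v = w] reads [(U + l) v = phi v *: e - w]: up to the scalar [phi v],
    the inverse of [U + l] determines [v]. *)
Context A U (phi : {linear V -> K^o}) (e : V) (l M N : K).
Hypothesis AE : forall v, A v = phi v *: e - U v.
Hypothesis injU : forall v, U v + l *: v = 0 -> v = 0.
Hypothesis surjU : forall v, exists2 g, U g + l *: g = v & `|g| <= M * `|v|.
Hypothesis phiN : forall v, `|phi v| <= N * `|v|.

Let rank_one_sub v : A v - l *: v = phi v *: e - (U v + l *: v).
Proof. by rewrite AE opprD addrA. Qed.

Let shiftB x y : U (x - y) + l *: (x - y) = (U x + l *: x) - (U y + l *: y).
Proof. by rewrite linearB scalerBr addrACA -opprD. Qed.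

Let shiftZ c x : U (c *: x) + l *: (c *: x) = c *: (U x + l *: x).
Proof. by rewrite linearZ/= scalerA mulrC -scalerA -scalerDr. Qed.

Let uniqU g h : U g + l *: g = U h + l *: h -> g = h.
Proof.
move=> gh; apply/eqP; rewrite -subr_eq0; apply/eqP/injU.
by rewrite shiftB gh subrr.
Qed.

(** An eigenvector [v] satisfies [(U + l) v = phi v *: e], so that it is a
    multiple of [E := (U + l)^-1 e]. *)
Lemma rank_one_eigenvectors : exists E, forall v, A v = l *: v -> exists c, v = c *: E.
Proof.
have [E EE _] := surjU e; exists E => v Av; exists (phi v).
have /eqP := rank_one_sub v; rewrite Av subrr eq_sym subr_eq0 => /eqP h.
by apply: uniqU; rewrite -h shiftZ EE.
Qed.

(** With [E := (U + l)^-1 e] and [h := (U + l)^-1 v], a solution of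
    [A g - l g = v] has the form [c E - h], and applying [phi] gives
    [c (1 - phi E) = - phi h]. The factor [1 - phi E] is nonzero, because
    [phi E = 1] would make [E] an eigenvector. *)
Lemma rank_one_resolvent : (forall v, A v = l *: v -> v = 0) -> 0 <= M -> 0 <= N ->
  resolvent_set A l.
Proof.
move=> inj M0 N0; have [E EE _] := surjU e.
have d0 : 1 - phi E != 0.
  apply/eqP => /eqP; rewrite subr_eq0 => /eqP phiE.
  have AE0 : A E = l *: E.
    by apply/eqP; rewrite -subr_eq0 rank_one_sub -phiE scale1r EE subrr.
  by move/inj: AE0 phiE => ->; rewrite linear0 => /eqP; rewrite oner_eq0.
apply: (@resolvent_intro _ _ (`|(1 - phi E)^-1| * (N * M) * `|E| + M)) => // v.
have [h hE hM] := surjU v.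
exists (- (phi h / (1 - phi E)) *: E - h); last first.
  rewrite mulrDl; apply: (le_trans (ler_normB _ _)); apply: lerD => //.
  rewrite normrZ normrN normrM [leRHS]mulrAC; apply: ler_wpM2r => //.
  rewrite mulrC -mulrA; apply: ler_wpM2l => //.
  by apply: (le_trans (phiN h)); rewrite -mulrA; apply: ler_wpM2l.
set c := - (phi h / _).
have -> : A (c *: E - h) - l *: (c *: E - h) = phi (c *: E - h) *: e - (c *: e - v).
  rewrite rank_one_sub; congr (_ - _).
  by rewrite shiftB shiftZ EE hE.
have -> : phi (c *: E - h) = c.
  rewrite linearB linearZ/= -[_ *: _]/(c * phi E) /c.
  by rewrite -[X in _ - X](divfK d0) mulNr -opprD -mulrDr [phi E + _]addrC subrK mulr1.
by rewrite opprB addrC subrK.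
Qed.

(** If [l] is an eigenvalue, then [phi E = 1] for [E := (U + l)^-1 e], and the
    linear form [phi \o (U + l)^-1], whose value at [e] is 1, vanishes on the
    range of [A - l]. This range is then not dense. *)
Lemma rank_one_dense_inj (X : set V) : dense (lin_span X) ->
  (forall x, X x -> exists g, A g - l *: g = x) -> 0 <= M -> 0 <= N ->
  forall v, A v = l *: v -> v = 0.
Proof.
move=> dX Xr M0 N0 v Av; apply: contrapT => /eqP v0.
have /eqP := rank_one_sub v; rewrite Av subrr eq_sym subr_eq0 => /eqP pv.
have phiv0 : phi v != 0.
  by apply: contra_neq v0 => p0; apply: injU; rewrite -pv p0 scale0r.
pose E := (phi v)^-1 *: v.
have EE : U E + l *: E = e.
  by rewrite shiftZ -pv scalerA mulVf// scale1r.
have phiE : phi E = 1 by rewrite linearZ/= -[_ *: _]/(_ * _) mulVf.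
clearbody E.
have eps0 : 0 < (N * M + 1)^-1 by rewrite invr_gt0 ltr_wpDl ?mulr_ge0.
(* A point [w] of the range so close to [e] that the form cannot vanish at [w]. *)
have [w [ew [n [a [x [Xx wE]]]]]] := dX _
  (ex_intro _ e (ballxx e eps0)) (ball_open e _).
have [g gE] : exists g, A g - l *: g = w.
  have /choice[gg ggE] : forall i, exists g, A g - l *: g = x i by move=> i; exact/Xr.
  exists (\sum_(i < n) a i *: gg i).
  rewrite linear_sum scaler_sumr -sumrB wE; apply: eq_bigr => i _.
  by rewrite linearZ/= scalerA mulrC -scalerA -scalerBr ggE.
have [h hE hM] := surjU (e - w).
have Eh : E - h = phi g *: E - g.
  apply: uniqU; rewrite !shiftB (shiftZ (phi g) E) EE hE opprB [e + _]addrC subrK.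
  by rewrite -rank_one_sub.
have /eqP : phi (E - h) = phi (phi g *: E - g) by rewrite Eh.
rewrite !linearB linearZ/= phiE [phi g *: 1]mulr1 subrr subr_eq0 => /eqP ph.
have : `|1 : K| < 1; last by rewrite normr1 ltxx.
rewrite ph; apply: (le_lt_trans (phiN h)).
apply: (@le_lt_trans _ _ (N * (M * `|e - w|))); first exact: ler_wpM2l.
rewrite -ph mulrA; have {}ew : `|e - w| < (N * M + 1)^-1.
  by have : ball e (N * M + 1)^-1 w := ew; rewrite -ball_normE.
have NM1 : 0 < N * M + 1 by rewrite ltr_wpDl ?mulr_ge0.
apply: (@le_lt_trans _ _ ((N * M + 1) * `|e - w|)).
  by apply: ler_wpM2r => //; rewrite lerDl.
by rewrite mulrC -ltr_pdivlMr// mul1r.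
Qed.

End operators.

(** * Classes of p-integrable functions on the unit interval *)

(** Typed so that instance resolution succeeds for functions on [R], the type
    underlying [measurableTypeR R]. *)
#[global] Instance ae_filter_mu01 (R : realType) :
  Filter (nbhs (almost_everywhere (mu01 R))).
Proof. exact: ae_filter_ringOfSetsType. Qed.

Section classes.
Context (R : realType) (p : R) (p1 : 1 <= p).
Local Notation C := R[i].
Local Notation mu := (mu01 R).
Local Notation LP := (cLspace mu p1).
Local Notation Lp := (cLfunType mu p1).
Local Open Scope quotient_scope.
Implicit Types f g : R -> C.

(** The class of a function, total so that it can be rewritten without carrying
    proofs of integrability. *)
Definition cls f : LP :=
  if pselect (f \in cLfun mu p) is left fL then \pi_LP (CLfun p1 fL) else 0.

Lemma clsE f (fL : f \in cLfun mu p) : cls f = \pi_LP (CLfun p1 fL).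
Proof.
rewrite /cls; case: pselect => // fL'; congr (\pi_LP _); exact: val_inj.
Qed.

Lemma cLspace_fun_cLfun (F : LP) : cLspace_fun F \in cLfun mu p.
Proof. exact: clfunP. Qed.

Lemma cls_fun (F : LP) : cls (cLspace_fun F) = F.
Proof.
rewrite (clsE (cLspace_fun_cLfun F)) -[RHS]reprK; congr (\pi_LP _).
exact: val_inj.
Qed.

Lemma cls_eq f g : f \in cLfun mu p -> g \in cLfun mu p ->
  cls f = cls g <-> f = g %[ae mu].
Proof. by move=> fL gL; rewrite !clsE; exact: cLspace_eqP. Qed.

Lemma fun_cls f : f \in cLfun mu p -> cLspace_fun (cls f) = f %[ae mu].
Proof.
by move=> fL; apply/cls_eq => //; [exact: cLspace_fun_cLfun|rewrite cls_fun].
Qed.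

Lemma norm_cls f : f \in cLfun mu p -> `|cls f| = (Lpnorm mu p f)%:C.
Proof. by move=> fL; rewrite clsE; exact: pi_cLnorm. Qed.

Lemma cLfunD f g : f \in cLfun mu p -> g \in cLfun mu p ->
  (fun x => f x + g x) \in cLfun mu p.
Proof. by move=> fL gL; exact: (rpredD fL gL). Qed.

Lemma cLfunZ a f : f \in cLfun mu p -> (fun x => a * f x) \in cLfun mu p.
Proof. by move=> fL; exact: (rpredZ a fL). Qed.

Lemma cls_lin a f g : f \in cLfun mu p -> g \in cLfun mu p ->
  cls (fun x => a * f x + g x) = a *: cls f + cls g.
Proof.
move=> fL gL; rewrite (clsE fL) (clsE gL) -pi_cLZ -pi_cLD.
by rewrite (clsE (cLfunD (cLfunZ a fL) gL)); congr (\pi_LP _); exact: val_inj.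
Qed.

Lemma cLfun0 : (fun=> 0 : C) \in cLfun mu p.
Proof. exact: rpred0. Qed.

Lemma clsD f g : f \in cLfun mu p -> g \in cLfun mu p ->
  cls (fun x => f x + g x) = cls f + cls g.
Proof.
move=> fL gL; rewrite -[cls f]scale1r -cls_lin//.
by congr cls; apply/funext => x; rewrite mul1r.
Qed.

Lemma cls0 : cls (fun=> 0) = 0.
Proof.
rewrite (clsE cLfun0); transitivity (\pi_LP (0 : Lp)); last by rewrite piE.
by congr (\pi_LP _); exact: val_inj.
Qed.

Lemma clsZ a f : f \in cLfun mu p -> cls (fun x => a * f x) = a *: cls f.
Proof.
move=> fL; rewrite -[RHS]addr0 -cls0 -cls_lin// ?cLfun0//.
by congr cls; apply/funext => x; rewrite addr0.
Qed.

Lemma clsB f g : f \in cLfun mu p -> g \in cLfun mu p ->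
  cls (fun x => f x - g x) = cls f - cls g.
Proof.
move=> fL gL; rewrite addrC -scaleN1r -cls_lin//.
by congr cls; apply/funext => x; rewrite mulN1r addrC.
Qed.

Lemma cLfunB f g : f \in cLfun mu p -> g \in cLfun mu p ->
  (fun x => f x - g x) \in cLfun mu p.
Proof. by move=> fL gL; exact: (rpredB fL gL). Qed.

Lemma cLfun_int f : f \in cLfun mu p -> cintegrable mu f.
Proof. by move=> fL; exact: (cLfun_integrable (CLfun p1 fL)). Qed.

Lemma volterra_cls alpha f : f \in cLfun mu p ->
  volterra alpha p1 (cls f) = cls (volterra_fun alpha f).
Proof.
move=> fL; rewrite (clsE fL) pi_volterra.
have vL : volterra_fun alpha f \in cLfun mu p := volterra_cLfun alpha (CLfun p1 fL).
by rewrite (clsE vL); congr (\pi_LP _); exact: val_inj.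
Qed.

Lemma cLfun_bounded f (M : R) : cmeasurable f -> (forall x, normc (f x) <= M) ->
  f \in cLfun mu p.
Proof.
move=> mf fM; apply/asboolP; split => //.
have /LfunE[mc fc] := @Lfun_cst _ _ _ mu M p.
apply: le_lt_trans fc; apply: Lnorm_le => //.
- exact: lt_le_trans p1.
- exact: measurable_normc.
- by move=> x /=; rewrite ger0_norm ?normc_ge0// (le_trans (fM x))// ler_norm.
Qed.

Lemma Lpnorm_le f g : f \in cLfun mu p -> g \in cLfun mu p ->
  (forall x, normc (f x) <= normc (g x)) -> Lpnorm mu p f <= Lpnorm mu p g.
Proof.
move=> fL gL fg.
rewrite -lee_fin (Lpnorm_fineK (CLfun p1 fL)) (Lpnorm_fineK (CLfun p1 gL)) /=.
apply: Lnorm_le => //.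
- exact: lt_le_trans p1.
- by apply: measurable_normc; case/asboolP: fL.
- by apply: measurable_normc; case/asboolP: gL.
- by move=> x; rewrite !ger0_norm ?normc_ge0.
Qed.

Lemma Lpnorm_cst (c : R) : 0 <= c -> Lpnorm mu p (fun=> c%:C) = c.
Proof.
move=> c0; have p0 : 0 < p by exact: lt_le_trans p1.
rewrite /Lpnorm unlock /Lnorm /=.
under eq_integral do rewrite expr0n/= addr0 sqrtr_sqr normr_id (ger0_norm c0).
rewrite integral_cst//= mu01_setT mule1.
by rewrite poweR_EFin -powRrM mulfV ?gt_eqF// powRr1.
Qed.

Lemma norm_cls_bounded f (M : R) : f \in cLfun mu p -> 0 <= M ->
  (forall x, normc (f x) <= M) -> `|cls f| <= M%:C.
Proof.
move=> fL M0 fM; rewrite norm_cls// lecR -[leRHS]Lpnorm_cst//.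
have mL : (fun=> M%:C) \in cLfun mu p.
  apply: (@cLfun_bounded _ M); first by split; exact: measurable_cst.
  by move=> x /=; rewrite expr0n/= addr0 sqrtr_sqr ger0_norm.
by apply: Lpnorm_le => // x; rewrite (le_trans (fM x))//= expr0n/= addr0 sqrtr_sqr ger0_norm.
Qed.

End classes.

(** * Neumann series of Volterra-type operators *)

(** Both [series b - series a] and [series b + series a] are nondecreasing, hence
    below their limits. *)
Lemma series_tail (R : realType) (a b : R^nat) :
  (forall i, `|a i| <= b i) -> cvgn (series b) ->
  cvgn (series a) /\
  forall m, `|limn (series a) - series a m| <= limn (series b) - series b m.
Proof.
move=> ab cb.
have b0 i : 0 <= b i by exact: le_trans (ab i).
have ca : cvgn (series a).
  by apply: normed_cvg; apply: (series_le_cvg _ _ _ cb) => i /=.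
split=> // m.
have c1 : series b n - series a n @[n --> \oo] --> limn (series b) - limn (series a).
  exact: cvgB.
have c2 : series b n + series a n @[n --> \oo] --> limn (series b) + limn (series a).
  exact: cvgD.
have h1 : series b m - series a m <= limn (series b) - limn (series a).
  rewrite -(cvg_lim _ c1)//.
  apply: (@nondecreasing_cvgn_le _ (fun n => series b n - series a n)).
    apply/nondecreasing_seqP => n; rewrite /series /= !big_nat_recr//=.
    by rewrite opprD addrACA lerDl subr_ge0 (le_trans (ler_norm _)).
  exact: (cvgP _ c1).
have h2 : series b m + series a m <= limn (series b) + limn (series a).
  rewrite -(cvg_lim _ c2)//.
  apply: (@nondecreasing_cvgn_le _ (fun n => series b n + series a n)).
    apply/nondecreasing_seqP => n; rewrite /series /= !big_nat_recr//=.
    by rewrite addrACA lerDl -lerBlDr sub0r (le_trans _ (ab n))// lerNl lerNnormlW.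
  exact: (cvgP _ c2).
by rewrite ler_norml; apply/andP; split; lra.
Qed.

(** The operator [K f x := int_(A x) f] is controlled by a weight [w] with values
    in [0, 1]: the hypothesis [hw] says that [K] maps [w ^ n / n!] below
    [w ^ n.+1 / n.+1!], exactly as integration from 0 to [x] does for
    [w x = x]. Iterating, [K ^ n] decreases like [1 / n!]. *)
Section neumann.
Context (R : realType) (p : R) (p1 : 1 <= p).
Local Notation C := R[i].
Local Notation mu := (mu01 R).
Variables (A : R -> set (measurableTypeR R)) (w : R -> R).
Hypothesis mA : forall x, measurable (A x).
Hypothesis mK : forall g : measurableTypeR R -> R,
  mu.-integrable setT (EFin \o g) ->
  measurable_fun (setT : set (measurableTypeR R)) (fun x => \int[mu]_(y in A x) g y).
Hypothesis mw : measurable_fun (setT : set (measurableTypeR R)) w.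
Hypothesis w01 : forall x, 0 <= w x <= 1.
Hypothesis hw : forall n x, \int[mu]_(y in A x) w y ^+ n <= w x ^+ n.+1 / n.+1%:R.
Implicit Types f g : R -> C.

Definition kint f x : C := cRintegral mu (A x) f.

Let N1 f : R := 2 * \int[mu]_y normc (f y).

Lemma normc_integrable f : cintegrable mu f ->
  mu.-integrable setT (EFin \o (fun y => normc (f y))).
Proof.
move=> [fr fi].
have mf : cmeasurable f.
  by split; apply/measurable_EFinP; [case/integrableP: fr|case/integrableP: fi].
have ia : mu.-integrable setT
    (EFin \o (fun y => `|complex.Re (f y)| + `|complex.Im (f y)|)).
  exact: (integrableD measurableT (integrable_abse fr) (integrable_abse fi)).
apply: le_integrable ia => //; first exact/measurable_EFinP/measurable_normc.
move=> x _; rewrite /= lee_fin ger0_norm ?normc_ge0// ger0_norm ?addr_ge0//.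
exact: normc_le_normReIm.
Qed.

Lemma int_normc_le : exists2 M : R, 0 <= M & forall f, f \in cLfun mu p ->
  \int[mu]_y normc (f y) <= M * Lpnorm mu p f.
Proof.
have [M M0 HM] := Lnorm1_le_Lnorm p1; exists M => // f fL.
have := HM _ (measurable_normc (cLfun_measurable (CLfun p1 fL))).
rewrite -(Lpnorm_fineK (CLfun p1 fL)) -EFinM Lnorm1.
under eq_integral do rewrite /= ger0_norm ?normc_ge0//.
move=> h; rewrite -lee_fin /Rintegral fineK//.
apply: integrable_fin_num => //; apply: normc_integrable; exact: (cLfun_int p1 fL).
Qed.

Lemma cintegrableD f g : cintegrable mu f -> cintegrable mu g ->
  cintegrable mu (fun x => f x + g x).
Proof.
move=> [fr fi] [gr gi]; split.
- rewrite (_ : EFin \o _ = (EFin \o (fun x => complex.Re (f x))) \+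
    (EFin \o (fun x => complex.Re (g x))))%E; first exact: integrableD.
  by apply/funext => x; rewrite /= cReD.
- rewrite (_ : EFin \o _ = (EFin \o (fun x => complex.Im (f x))) \+
    (EFin \o (fun x => complex.Im (g x))))%E; first exact: integrableD.
  by apply/funext => x; rewrite /= cImD.
Qed.

Lemma cintegrableN f : cintegrable mu f -> cintegrable mu (fun x => - f x).
Proof.
move=> [fr fi]; split.
- rewrite (_ : EFin \o _ = (fun x => - (EFin \o (fun x => complex.Re (f x))) x))%E.
    exact: integrableN.
  by apply/funext => x /=; case: (f x).
- rewrite (_ : EFin \o _ = (fun x => - (EFin \o (fun x => complex.Im (f x))) x))%E.
    exact: integrableN.
  by apply/funext => x /=; case: (f x).
Qed.

Lemma cintegrableB f g : cintegrable mu f -> cintegrable mu g ->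
  cintegrable mu (fun x => f x - g x).
Proof. by move=> fi gi; exact: cintegrableD fi (cintegrableN gi). Qed.

(** The factor 2 comes from bounding real and imaginary parts separately; its
    powers are absorbed in the exponential series. *)
Lemma kint_bound f (g : R -> R) x : cintegrable mu f ->
  mu.-integrable setT (EFin \o g) -> (forall y, normc (f y) <= g y) ->
  normc (kint f x) <= 2 * \int[mu]_(y in A x) g y.
Proof.
move=> [fr fi] ig fg; apply: (le_trans (normc_le_normReIm _)).
have IA (h : R -> R) : mu.-integrable setT (EFin \o h) ->
    mu.-integrable (A x) (EFin \o h) by exact: integrableS.
have main (h : R -> R) : mu.-integrable setT (EFin \o h) ->
    (forall y, `|h y| <= normc (f y)) ->
    `|\int[mu]_(y in A x) h y| <= \int[mu]_(y in A x) g y.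
  move=> ih hf; apply: (le_trans (le_normr_Rintegral (mA x) (IA _ ih))).
  apply: le_Rintegral => //; [exact: (IA _ (integrable_abse ih))|exact: IA|].
  by move=> y _; exact: le_trans (hf y) (fg y).
rewrite mulr2n mulrDl mul1r; apply: lerD; apply: main => // y.
- exact: normc_ge_normRe.
- exact: normc_ge_normIm.
Qed.

Lemma kint_bound1 f x : cintegrable mu f -> normc (kint f x) <= N1 f.
Proof.
move=> fi; have ni := normc_integrable fi.
apply: (le_trans (kint_bound x fi ni (fun y => lexx _))).
rewrite ler_pM2l// fine_le//.
- by apply: integrable_fin_num => //; exact: integrableS ni.
- exact: integrable_fin_num.
- apply: ge0_subset_integral => //.
  + by case/integrableP: ni.
  + by move=> y _; rewrite lee_fin normc_ge0.
Qed.

Lemma kint_cLfun f : cintegrable mu f -> kint f \in cLfun mu p.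
Proof.
move=> fi; apply: (@cLfun_bounded _ _ p1 _ (N1 f)); last by move=> x; exact: kint_bound1.
by case: fi => fr fi; split; exact: mK.
Qed.

Lemma kint_lin a f g x : cintegrable mu f -> cintegrable mu g ->
  kint (fun x => a * f x + g x) x = a * kint f x + kint g x.
Proof. by move=> fi gi; exact: cRintegral_linear. Qed.

Lemma kintD f g x : cintegrable mu f -> cintegrable mu g ->
  kint (fun x => f x + g x) x = kint f x + kint g x.
Proof.
move=> fi gi; rewrite -[kint f x]mul1r -kint_lin//.
by congr cRintegral; apply/funext => y; rewrite mul1r.
Qed.

Lemma kintB f g x : cintegrable mu f -> cintegrable mu g ->
  kint (fun x => f x - g x) x = kint f x - kint g x.
Proof.
move=> fi gi; rewrite addrC -mulN1r -kint_lin//.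
by congr cRintegral; apply/funext => y; rewrite mulN1r addrC.
Qed.

Variable z : C.
Let r : R := 2 * normc z.

(** [kiter f n] is [(z K) ^ n.+1 f]. The first term of the Neumann series is left
    out because [f] need not be bounded whereas [K f] is. *)
Fixpoint kiter f n : R -> C :=
  if n is n'.+1 then fun x => z * kint (kiter f n') x else fun x => z * kint f x.

Lemma kiter_cLfun f n : cintegrable mu f -> kiter f n \in cLfun mu p.
Proof.
move=> fi; elim: n => [|n IH]; apply: cLfunZ => //; apply: kint_cLfun => //.
exact: (cLfun_int p1 IH).
Qed.

Lemma w_integrable c n : mu.-integrable setT (EFin \o (fun y => c * w y ^+ n)).
Proof.
apply: measurable_bounded_integrable => //.
- by rewrite (_ : (_ < _)%E = (mu setT < +oo)%E)// mu01_setT ltry.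
- by apply: measurable_funM => //; exact: measurable_funX.
- exists `|c|; split; first exact: num_real.
  move=> M cM x _; have /andP[w0 w1] := w01 x.
  rewrite /= normrM (ger0_norm (exprn_ge0 n w0)) (le_trans _ (ltW cM))//.
  by rewrite ler_piMr// exprn_ile1.
Qed.

Lemma kiter_bound f n x : cintegrable mu f ->
  normc (kiter f n x) <= (normc z * N1 f) * (r ^+ n / n`!%:R) * w x ^+ n.
Proof.
move=> fi; elim: n x => [|n IH] x.
  by rewrite expr0 mulr1 divr1 mulr1 normcM ler_wpM2l ?normc_ge0// kint_bound1.
rewrite /= normcM.
have := @kint_bound _ _ x (cLfun_int p1 (kiter_cLfun n fi))
  (w_integrable ((normc z * N1 f) * (r ^+ n / n`!%:R)) n) (fun y => IH y).
rewrite RintegralZl//; last first.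
  by have := w_integrable 1 n; under eq_fun do rewrite mul1r; exact: integrableS.
move=> h; apply: (@le_trans _ _ (normc z * (2 * (normc z * N1 f * (r ^+ n / n`!%:R) *
   (w x ^+ n.+1 / n.+1%:R))))).
  apply: ler_wpM2l; first exact: normc_ge0.
  apply: (le_trans h); rewrite ler_pM2l//; apply: ler_wpM2l => //.
  rewrite mulr_ge0 ?mulr_ge0 ?normc_ge0 ?Rintegral_ge0// ?divr_ge0 ?exprn_ge0 ?mulr_ge0 ?normc_ge0//.
  by move=> y _; exact: normc_ge0.
rewrite le_eqVlt; apply/orP; left; apply/eqP.
rewrite factS natrM [in RHS]exprS /r.
have f0 : n`!%:R != 0 :> R by rewrite pnatr_eq0 -lt0n fact_gt0.
have n0 : 1 + n%:R != 0 :> R by rewrite nat1r pnatr_eq0.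
by field; rewrite f0 n0.
Qed.

Lemma kbound_w1 f n x :
  (normc z * N1 f) * (r ^+ n / n`!%:R) * w x ^+ n <= (normc z * N1 f) * exp_coeff r n.
Proof.
rewrite ler_piMr//.
  rewrite mulr_ge0 ?mulr_ge0 ?normc_ge0 ?Rintegral_ge0// ?divr_ge0 ?exprn_ge0 ?mulr_ge0 ?normc_ge0//.
  by move=> y _; exact: normc_ge0.
by have /andP[w0 w1] := w01 x; exact: exprn_ile1.
Qed.

Section sum.
Variable f : R -> C.
Hypothesis fi : cintegrable mu f.

Let t := kiter f.
Let b : R^nat := (normc z * N1 f) *: exp_coeff r.

Let cb : cvgn (series b).
Proof. by apply: is_cvg_seriesZ; exact: is_cvg_series_exp_coeff. Qed.

Let tb n x : normc (t n x) <= b n.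
Proof.
exact: le_trans (kiter_bound n x fi) (kbound_w1 _ _ _).
Qed.

Let ret x n : `|complex.Re (t n x)| <= b n.
Proof. exact: le_trans (normc_ge_normRe _) (tb n x). Qed.

Let imt x n : `|complex.Im (t n x)| <= b n.
Proof. exact: le_trans (normc_ge_normIm _) (tb n x). Qed.

(** The sum of the Neumann series of [z K] at [f], without its first term. It is
    a pointwise sum of real and imaginary parts, which converges uniformly. *)
Definition kres x : C :=
  limn (series (fun n => complex.Re (t n x))) +i* limn (series (fun n => complex.Im (t n x))).

Fixpoint kpart n : R -> C :=
  if n is n'.+1 then fun x => kpart n' x + t n' x else fun=> 0.

Let kpartE n x : kpart n x = series (fun n => complex.Re (t n x)) n +i*
  series (fun n => complex.Im (t n x)) n.
Proof.
elim: n => [|n /= ->]; first by rewrite /series /= !big_geq.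
rewrite /series /= !big_nat_recr//=; case: (t n x) => u v /=.
by [].
Qed.

Let tail n : R := limn (series b) - series b n.

Let kres_tail n x : normc (kres x - kpart n x) <= 2 * tail n.
Proof.
apply: (le_trans (normc_le_normReIm _)); rewrite kpartE /= mulr2n mulrDl mul1r.
by apply: lerD; apply: (series_tail _ cb).2; [exact: ret|exact: imt].
Qed.

Lemma kres_bound x : normc (kres x) <= 2 * (normc z * expR r * N1 f).
Proof.
have := kres_tail 0 x; rewrite subr0 /tail [series b 0]/series /= big_geq// subr0.
rewrite lim_seriesZ; last exact: is_cvg_series_exp_coeff.
by rewrite -[_ *: _]/(_ * expR r) mulrAC.
Qed.

Let t_cLfun n : t n \in cLfun mu p.
Proof. exact: kiter_cLfun. Qed.

Lemma kres_cLfun : kres \in cLfun mu p.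
Proof.
apply: (@cLfun_bounded _ _ p1 _ (2 * (normc z * expR r * N1 f))); last exact: kres_bound.
have mt n : cmeasurable (t n) by have /asboolP[] := t_cLfun n.
have ms (h : (R -> R)^nat) : (forall n, measurable_fun (setT : set (measurableTypeR R)) (h n)) ->
    forall n, measurable_fun (setT : set (measurableTypeR R)) (fun x => series (fun n => h n x) n).
  move=> mh; elim => [|n IH].
    by rewrite /series/=; under eq_fun do rewrite big_geq//; exact: measurable_cst.
  rewrite /series/=; under eq_fun do rewrite big_nat_recr//=.
  exact: measurable_funD.
split.
- apply: (@measurable_fun_cvg _ _ _ _ (fun m x => series (fun n => complex.Re (t n x)) m)).
    by apply: ms => n; case: (mt n).
  by move=> x _; exact: (series_tail (ret x) cb).1.
- apply: (@measurable_fun_cvg _ _ _ _ (fun m x => series (fun n => complex.Im (t n x)) m)).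
    by apply: ms => n; case: (mt n).
  by move=> x _; exact: (series_tail (imt x) cb).1.
Qed.

Let kpart_cLfun n : kpart n \in cLfun mu p.
Proof. by elim: n => [|n IH] /=; [exact: cLfun0|exact: cLfunD]. Qed.

Let fpi n : cintegrable mu (fun y => f y + kpart n y).
Proof. exact: cintegrableD fi (cLfun_int p1 (kpart_cLfun n)). Qed.

Let kpartS n x : kpart n.+1 x = z * kint (fun y => f y + kpart n y) x.
Proof.
elim: n x => [|n IH] x.
  by rewrite /= add0r /t /=; congr (_ * kint _ _); apply/funext => y; rewrite addr0.
rewrite [LHS]/= -/(kpart n.+1 x) IH -[t n.+1 x]/(z * kint (t n) x) -mulrDr -kintD//; last first.
  exact: (cLfun_int p1 (t_cLfun n)).
by congr (_ * kint _ _); apply/funext => y; rewrite addrA.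
Qed.

(** The partial sums satisfy [S n.+1 = z K (f + S n)] and converge uniformly,
    which lets [K] pass to the limit. *)
Lemma kres_eq x : kres x = z * kint (fun y => f y + kres y) x.
Proof.
have fri := cintegrableD fi (cLfun_int p1 kres_cLfun).
(* The error of the partial sums bounds the defect of the limit equation. *)
have tail0 : tail n @[n --> \oo] --> 0.
  by rewrite -(subrr (limn (series b))); apply: cvgB => //; exact: cvg_cst.
have key n : normc (kres x - z * kint (fun y => f y + kres y) x) <=
    2 * tail n.+1 + normc z * (2 * (2 * tail n)).
  rewrite -(subrK (kpart n.+1 x) (kres x)) -addrA.
  apply: (le_trans (le_normcD _ _)); apply: lerD => //.
  rewrite kpartS -mulrBr -kintB// normcM ler_wpM2l ?normc_ge0//.
  have h y : normc (f y + kpart n y - (f y + kres y)) <= 2 * tail n.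
    by rewrite opprD addrACA subrr add0r -normcN opprB.
  have t0 : 0 <= 2 * tail n.
    by rewrite (le_trans _ (kres_tail n x))// normc_ge0.
  have ic := w_integrable (2 * tail n) 0.
  apply: (@le_trans _ _ (2 * \int[mu]_(y in A x) (2 * tail n * w y ^+ 0))).
    apply: kint_bound => //; last by move=> y; rewrite expr0 mulr1.
    exact: cintegrableB.
  rewrite ler_pM2l// RintegralZl//; last first.
    by have := w_integrable 1 0; under eq_fun do rewrite mul1r; exact: integrableS.
  rewrite ler_piMr// (le_trans (hw 0 x))// expr1 divr1.
  by case/andP: (w01 x).
apply/eqP; rewrite -subr_eq0; apply/eqP/eq0_normc/eqP.
rewrite eq_le normc_ge0 andbT.
have lim0 : 2 * tail n.+1 + normc z * (2 * (2 * tail n)) @[n --> \oo] -->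
    2 * 0 + normc z * (2 * (2 * 0)).
  have tail0' : tail n.+1 @[n --> \oo] --> 0 by rewrite -(cvg_shiftS tail) in tail0.
  by apply: cvgD; repeat (apply: cvgM; first exact: cvg_cst).
rewrite !mulr0 addr0 in lim0.
by apply: (cvgr_to_ge lim0); exact: nearW.
Qed.

End sum.
(** A fixed point of [z K] is also one of [(z K) ^ n.+1] for every [n], hence is
    bounded by the terms of a convergent exponential series. *)
Lemma kint_eigen f : f \in cLfun mu p -> f = (fun x => z * kint f x) %[ae mu] ->
  f = (fun=> 0) %[ae mu].
Proof.
move=> fL fE; have fi := cLfun_int p1 fL.
have iterE n : kiter f n = kiter f 0.
  elim: n => [//|n IH]; apply/funext => x.
  rewrite [LHS]/= IH; congr (_ * _); apply: ae_eq_cRintegral => //.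
    exact: (cLfun_int p1 (kiter_cLfun 0 fi)).
  exact: ae_eq_sym.
suff f0 x : kiter f 0 x = 0 by apply: (filterS _ fE) => x h /h ->; exact: f0.
 apply: eq0_normc; apply/eqP; rewrite eq_le normc_ge0 andbT.
have c0 : (normc z * N1 f) * exp_coeff r n @[n --> \oo] --> (normc z * N1 f) * 0.
  by apply: cvgM; [exact: cvg_cst|exact: cvg_exp_coeff].
rewrite mulr0 in c0; apply: (cvgr_to_ge c0); apply: nearW => n.
by rewrite -(iterE n); exact: le_trans (kiter_bound n x fi) (kbound_w1 _ _ _).
Qed.

Local Notation LP := (cLspace mu p1).

Lemma kint_neumann (B : LP -> LP) :
  (forall f, f \in cLfun mu p -> B (cls p1 f) = cls p1 (kint f)) ->
  (forall g : LP, g = z *: B g -> g = 0) /\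
  exists2 M : C, 0 <= M & forall v : LP, exists2 g : LP, g - z *: B g = v & `|g| <= M * `|v|.
Proof.
move=> BE; split.
  move=> g; rewrite -(cls_fun g); move: (cLspace_fun_cLfun g).
  move: (cLspace_fun g) => f fL; have fi := cLfun_int p1 fL.
  rewrite BE// -clsZ ?kint_cLfun// => /cls_eq h.
  rewrite -(cls0 p1); apply/cls_eq => //; first exact: cLfun0.
  by apply: kint_eigen => //; apply: h => //; apply: cLfunZ => //; exact: (kint_cLfun fi).
have [M1 M10 NM] := int_normc_le.
pose M := 1 + 2 * (normc z * expR r * (2 * M1)).
have M0 : 0 <= 2 * (normc z * expR r * (2 * M1)).
  by rewrite !mulr_ge0 ?normc_ge0 ?expR_ge0.
exists M%:C; first by rewrite lecR /M addr_ge0.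
move=> v; rewrite -(cls_fun v); move: (cLspace_fun_cLfun v).
move: (cLspace_fun v) => f fL; have fi := cLfun_int p1 fL.
have kL := kres_cLfun fi.
have fkL := cLfunD p1 fL kL.
exists (cls p1 (fun x => f x + kres f x)).
  have kfkL := kint_cLfun (cLfun_int p1 fkL).
  rewrite BE// -clsZ// -clsB//; last exact: cLfunZ.
  by congr cls; apply/funext => x; rewrite -kres_eq// addrK.
rewrite clsD// /M rmorphD/= mulrDl mul1r; apply: (le_trans (ler_normD _ _)).
apply: lerD => //.
apply: (le_trans (norm_cls_bounded p1 kL _ (kres_bound fi))).
  by rewrite !mulr_ge0 ?normc_ge0 ?expR_ge0// Rintegral_ge0// => y _; exact: normc_ge0.
rewrite norm_cls// -rmorphM lecR -!mulrA ler_pM2l//; apply: ler_wpM2l; first exact: normc_ge0.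
by apply: ler_wpM2l; [exact: expR_ge0|rewrite ler_pM2l// NM].
Qed.

End neumann.

(** * The two weights *)

Section weights.
Context (R : realType).
Local Notation mu := (mu01 R).
Local Notation leb := (@lebesgue_measure R).
Implicit Types (g F f : R -> R) (D : set (measurableTypeR R)).

Lemma mu01_lebesgue D (f : R -> \bar R) :
  measurable D -> D `<=` (`[0, 1]%classic : set R) ->
  (\int[mu]_(y in D) f y = \int[leb]_(y in D) f y)%E.
Proof.
move=> mD D01; apply: eq_measure_integral => B mB BD.
by rewrite -[LHS]/(leb (B `&` `[0%R, 1%R])) setIidl//; exact: subset_trans D01.
Qed.

Lemma mu01_out : (mu (~` `[0%R, 1%R]) = 0)%E.
Proof. by rewrite -[LHS]/(leb (~` `[0%R, 1%R] `&` `[0%R, 1%R])) setICl measure0. Qed.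

Lemma mu01_restrict D g : measurable D -> mu.-integrable setT (EFin \o g) ->
  \int[mu]_(y in D) g y = \int[leb]_(y in D `&` `[0, 1]) g y.
Proof.
move=> mD ig; congr fine; rewrite -mu01_lebesgue//; last exact: measurableI.
rewrite (@negligible_integral _ _ _ mu D (~` `[0%R, 1%R]))//.
- by rewrite setDE setCK.
- exact: measurableC.
- exact: integrableS ig.
- exact: mu01_out.
Qed.

Lemma continuous_poly (q : {poly R}) : continuous (horner q).
Proof.
move=> x; apply: differentiable_continuous; apply/derivable1_diffP.
exact: derivable_horner.
Qed.

Lemma int_deriv_poly (q : {poly R}) (a b : R) : a <= b ->
  \int[leb]_(x in `[a, b]) q^`().[x] = q.[b] - q.[a].
Proof.
rewrite le_eqVlt => /predU1P[<-|ab].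
  by rewrite set_itv1 Rintegral_set1 subrr.
rewrite /Rintegral (@continuous_FTC2 _ (horner q^`()) (horner q))//.
- exact/continuous_subspaceT/continuous_poly.
- split=> [x _||]; first exact: derivable_horner.
  + by apply: cvg_at_right_filter; exact: continuous_poly.
  + by apply: cvg_at_left_filter; exact: continuous_poly.
- by move=> x _; rewrite derivE.
Qed.

(** The weight for integration over [0, x ^ alpha]. It is 1 outside [0, 1], so that
    the bounds hold at every real [x] and not only almost everywhere. *)
Definition clip01 (x : R) : R := if 0 <= x <= 1 then x else 1.

(** The weight for integration over the complement of [0, x ^ alpha]. *)
Definition coclip01 (x : R) : R := if 0 <= x <= 1 then 1 - x else 1.

Lemma clip01_01 x : 0 <= clip01 x <= 1.
Proof. by rewrite /clip01; case: ifPn => // _; rewrite ler01 lexx. Qed.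

Lemma coclip01_01 x : 0 <= coclip01 x <= 1.
Proof.
by rewrite /coclip01; case: ifPn => [/andP[a b]|_]; rewrite ?ler01 ?lexx//; lra.
Qed.

Lemma measurable_clip01 : measurable_fun (setT : set (measurableTypeR R)) clip01.
Proof.
apply: measurable_fun_ifT => //; apply: measurable_and.
  exact: measurable_fun_ler.
exact: measurable_fun_ler.
Qed.

Lemma measurable_coclip01 : measurable_fun (setT : set (measurableTypeR R)) coclip01.
Proof.
apply: measurable_fun_ifT => //; last exact: measurable_funB.
by apply: measurable_and; exact: measurable_fun_ler.
Qed.

Lemma bounded_integrable01 g M :
  measurable_fun (setT : set (measurableTypeR R)) g -> (forall x, `|g x| <= M) ->
  mu.-integrable setT (EFin \o g).
Proof.
move=> mg gM; apply: measurable_bounded_integrable => //.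
  by rewrite (_ : (_ < _)%E = (mu setT < +oo)%E)// mu01_setT ltry.
exists M; split; first exact: num_real.
by move=> N MN x _; exact: le_trans (gM x) (ltW MN).
Qed.

Lemma pow_integrable01 g n :
  measurable_fun (setT : set (measurableTypeR R)) g -> (forall x, 0 <= g x <= 1) ->
  mu.-integrable setT (EFin \o (fun x => g x ^+ n)).
Proof.
move=> mg g01; apply: (@bounded_integrable01 _ 1); first exact: measurable_funX.
by move=> x; have /andP[g0 g1] := g01 x; rewrite ger0_norm ?exprn_ge0// exprn_ile1.
Qed.

Lemma int_clip01 n (t : R) : 0 <= t ->
  \int[mu]_(y in `[0, t]) clip01 y ^+ n = Num.min t 1 ^+ n.+1 / n.+1%:R.
Proof.
move=> t0; rewrite mu01_restrict//; last first.
  exact: pow_integrable01 measurable_clip01 clip01_01.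
have -> : `[0, t]%classic `&` `[0, 1]%classic = `[0, Num.min t 1]%classic :> set R.
  apply/seteqP; split=> y /=; rewrite !in_itv/= le_min.
    by move=> [/andP[-> ->] /andP[_ ->]].
  by move=> /and3P[-> -> ->].
transitivity (\int[leb]_(y in `[0%R, Num.min t 1]) y ^+ n).
  apply: eq_Rintegral => y; rewrite inE/= in_itv/= le_min => /and3P[y0 _ y1].
  by rewrite /clip01 y0 y1.
pose q : {poly R} := n.+1%:R^-1 *: 'X^(n.+1).
have dq x : q^`().[x] = x ^+ n.
  by rewrite /q derivZ derivXn hornerZ hornerMn hornerXn mulrnAr -mulrnAl -[_ *+ _]mulr_natr mulVf ?mul1r.
transitivity (\int[leb]_(y in `[0%R, Num.min t 1]) q^`().[y]).
  by apply: eq_Rintegral => y _; rewrite dq.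
rewrite int_deriv_poly ?le_min ?t0 ?ler01// /q !hornerZ !hornerXn expr0n/= mulr0 subr0.
by rewrite mulrC.
Qed.

Lemma int_coclip01 n (t : R) : 0 <= t ->
  \int[mu]_(y in ~` `[0, t]) coclip01 y ^+ n = (1 - Num.min t 1) ^+ n.+1 / n.+1%:R.
Proof.
move=> t0; have mC : measurable (~` `[0%R, t] : set (measurableTypeR R)).
  exact: measurableC.
have mt : Num.min t 1 <= 1 by rewrite ge_min lexx orbT.
rewrite mu01_restrict//; last first.
  exact: pow_integrable01 measurable_coclip01 coclip01_01.
have -> : ~` `[0, t]%classic `&` `[0, 1]%classic = `]Num.min t 1, 1]%classic :> set R.
  apply/seteqP; split=> y /=; rewrite !in_itv/= gt_min.
    move=> [h /andP[y0 y1]]; rewrite y1 andbT; apply/orP; left.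
    by rewrite ltNge; apply/negP => yt; apply: h; rewrite y0.
  move=> /andP[/orP[ty|/lt_le_trans h /h]]; last by rewrite ltxx.
  move=> y1; rewrite y1 (ltW (le_lt_trans t0 ty)); split=> //.
  by rewrite leNgt ty andbF.
pose q : {poly R} := - n.+1%:R^-1 *: (1 - 'X) ^+ n.+1.
have dq x : q^`().[x] = (1 - x) ^+ n.
  rewrite /q derivZ deriv_exp derivB derivX -polyC1 derivC polyC1 sub0r mulN1r mulNrn scaleNr scalerN opprK.
  rewrite hornerZ hornerMn !hornerE. by rewrite -(mulr_natl (_ ^+ _)) mulrA mulVf// mul1r.
transitivity (\int[leb]_(y in `]Num.min t 1, 1]) q^`().[y]).
  apply: eq_Rintegral => y; rewrite inE/= in_itv/= dq => /andP[ty y1].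
  by rewrite /coclip01 y1 andbT (le_trans _ (ltW ty))// le_min t0 ler01.
rewrite Rintegral_itv_obnd_cbnd; last first.
  apply: (@integrableS _ _ _ leb `[Num.min t 1, 1]) => //.
    exact: subset_itv_oc_cc.
  apply: continuous_compact_integrable; first exact: segment_compact.
  exact/continuous_subspaceT/continuous_poly.
rewrite int_deriv_poly// /q !hornerE.
by rewrite subrr expr0n/= mulr0 sub0r mulNr opprK mulrC.
Qed.

End weights.

(** * Quasinilpotence for nonzero spectral parameters *)

Lemma powR_anti (R : realType) (x a b : R) : 0 <= x <= 1 -> 0 < b -> b <= a ->
  x `^ a <= x `^ b.
Proof.
move=> /andP[x0 x1] b0 ba; have a0 := lt_le_trans b0 ba.
have [->|xn0] := eqVneq x 0; first by rewrite !powR0// gt_eqF.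
rewrite /powR (negPf xn0) ler_expR ler_wnM2r//.
by rewrite ln_le0.
Qed.

Section quasinilpotent.
Context (R : realType) (p : R) (p1 : 1 <= p) (alpha : R).
Hypothesis alpha0 : 0 < alpha.
Local Notation C := R[i].
Local Notation mu := (mu01 R).
Local Notation LP := (cLspace mu p1).
Local Notation T := (volterra alpha p1).

Let mpow : measurable_fun (setT : set (measurableTypeR R)) (fun x => (x : R) `^ alpha).
Proof. exact: measurable_powR. Qed.

Let measurable_volterra (g : measurableTypeR R -> R) : mu.-integrable setT (EFin \o g) ->
  measurable_fun (setT : set (measurableTypeR R))
    (fun x => \int[mu]_(y in `[0, x `^ alpha]) g y).
Proof. by move=> ig; exact: (measurableT_comp (measurable_primitive01 ig) mpow). Qed.

Lemma min_pow_clip01 x : 1 <= alpha -> Num.min (x `^ alpha) 1 <= clip01 x.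
Proof.
move=> a1; rewrite /clip01; case: ifPn => [/andP[x0 x1]|_]; last by rewrite ge_min lexx orbT.
by rewrite ge_min -[X in _ <= X]powRr1// powR_anti// x0.
Qed.

Lemma shift_inj (V : lmodType C) (B : V -> V) (l : C) : l != 0 ->
  (forall g, g = - l^-1 *: B g -> g = 0) -> forall v, B v + l *: v = 0 -> v = 0.
Proof.
move=> l0 inj v /eqP; rewrite addrC addr_eq0 => /eqP Bv; apply: inj.
by rewrite scaleNr -scalerN -Bv scalerA mulVf// scale1r.
Qed.

Lemma shift_surj (V : normedModType C) (B : V -> V) (l M : C) : l != 0 ->
  (forall v, exists2 g, g - (- l^-1) *: B g = v & `|g| <= M * `|v|) ->
  forall v, exists2 g, B g + l *: g = v & `|g| <= (M * `|l^-1|) * `|v|.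
Proof.
move=> l0 surj v; have [g gE gM] := surj (l^-1 *: v); exists g.
  apply: (scalerI (invr_neq0 l0)).
  by rewrite -gE scalerDr scalerA mulVf// scale1r addrC scaleNr opprK.
by rewrite -mulrA -normrZ.
Qed.

(** For [1 <= alpha] the interval [0, x ^ alpha] is contained in [0, x], hence
    the iterates of [T] are dominated by those of the classical Volterra operator. *)
Lemma volterra_ge1_resolvent l : 1 <= alpha -> l != 0 -> resolvent_set T l.
Proof.
move=> a1 l0; have l0' : - l != 0 by rewrite oppr_eq0.
have /= := @kint_neumann _ _ p1 (fun x => `[0%R, x `^ alpha]%classic) (@clip01 R)
  (fun x => measurable_itv _) measurable_volterra (@measurable_clip01 R)
  (@clip01_01 R) _ (- (- l)^-1) T.
case.
- move=> n x; rewrite int_clip01 ?powR_ge0// ler_pM2r ?invr_gt0//.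
  apply: lerXn2r; rewrite ?nnegrE.
  - by rewrite le_min powR_ge0 ler01.
  - by case/andP: (clip01_01 x).
  exact: min_pow_clip01.
- by move=> f fL; rewrite volterra_cls.
move=> inj [M M0 surj].
apply: (@resolvent_intro _ _ T l (M * `|(- l)^-1|)).
  by move=> v /eqP; rewrite -subr_eq0 -scaleNr => /eqP; exact: shift_inj.
by move=> v; have [g gE gM] := shift_surj l0' surj v; exists g => //; rewrite -scaleNr.
Qed.

Definition total_int (F : LP) : C^o := cRintegral mu setT (cLspace_fun F).

Lemma total_int_cls f : f \in cLfun mu p -> total_int (cls p1 f) = cRintegral mu setT f.
Proof.
move=> fL; apply: ae_eq_cRintegral => //; last exact: fun_cls.
- exact/(cLfun_int p1)/cLspace_fun_cLfun.
- exact: (cLfun_int p1).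
Qed.

Lemma total_int_linear : linear total_int.
Proof.
move=> a F G; rewrite -(cls_fun F) -(cls_fun G).
move: (cLspace_fun_cLfun F) (cLspace_fun_cLfun G).
move: (cLspace_fun F) (cLspace_fun G) => f g fL gL.
rewrite -cls_lin// !total_int_cls//; last exact: (cLfunD p1 (cLfunZ p1 a fL) gL).
by apply: cRintegral_linear => //; exact: (cLfun_int p1).
Qed.

HB.instance Definition _ := GRing.isLinear.Build C LP C^o _ total_int total_int_linear.

Lemma total_int_bounded : exists2 N : C, 0 <= N & forall F, `|total_int F| <= N * `|F|.
Proof.
have [M M0 HM] := int_normc_le p1.
exists (2 * M)%:C; first by rewrite lecR mulr_ge0.
move=> F; rewrite -(cls_fun F); move: (cLspace_fun_cLfun F).
move: (cLspace_fun F) => f fL; rewrite total_int_cls// norm_cls//.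
rewrite -[`|_|]/((normc _)%:C) -rmorphM lecR.
apply: (le_trans (@kint_bound1 _ (fun=> setT) (fun=> measurableT) f 0 (cLfun_int p1 fL))).
by rewrite -mulrA ler_pM2l// HM.
Qed.

Definition one01 : LP := cls p1 (fun=> 1).

Lemma one01_cLfun : (fun=> 1 : C) \in cLfun mu p.
Proof.
apply: (@cLfun_bounded _ _ p1 _ 1); first by split; exact: measurable_cst.
by move=> x; rewrite normc1.
Qed.

(** The integral over the complement of [0, x ^ alpha]: the operator [T] is the
    rank-one operator [total_int (.) *: one01] minus this one. *)
Definition covolterra (F : LP) : LP := total_int F *: one01 - T F.

Lemma covolterra_linear : linear covolterra.
Proof.
move=> a F G; rewrite /covolterra [T _]linearP [a *: (_ - _)]scalerBr.
have -> : total_int (a *: F + G) = a * total_int F + total_int G by rewrite linearP.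
rewrite scalerDl -scalerA.
by rewrite opprD addrACA.
Qed.

HB.instance Definition _ := GRing.isLinear.Build C LP LP _ covolterra covolterra_linear.

Lemma volterraE F : T F = total_int F *: one01 - covolterra F.
Proof. by rewrite /covolterra opprB addrC subrK. Qed.

Lemma covolterra_cls f : f \in cLfun mu p -> covolterra (cls p1 f) =
  cls p1 (kint (fun x => ~` `[0%R, x `^ alpha]%classic) f).
Proof.
move=> fL; rewrite /covolterra total_int_cls// volterra_cls// -clsZ ?one01_cLfun//.
have vL : volterra_fun alpha f \in cLfun mu p := volterra_cLfun alpha (CLfun p1 fL).
rewrite -clsB//; last by apply: (cLfunZ p1); exact: one01_cLfun.
congr cls; apply/funext => x; rewrite mulr1.
have [fr fi] := cLfun_int p1 fL.
have main g : mu.-integrable setT (EFin \o g) -> \int[mu]_y g y -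
  \int[mu]_(y in `[0%R, x `^ alpha]) g y = \int[mu]_(y in ~` `[0%R, x `^ alpha]) g y.
  move=> ig; rewrite -[in LHS](setUv `[0%R, x `^ alpha]%classic).
  rewrite Rintegral_setU ?setUv//.
  - by rewrite addrC addKr.
  - exact: measurableC.
  - by apply/disj_setPS => y [].
by rewrite /kint /cRintegral -!main.
Qed.

(** For [alpha <= 1] the interval [x ^ alpha, 1] is contained in [x, 1], and the
    weight [1 - x] plays the role that [x] plays for [1 <= alpha]. *)
Lemma covolterra_shift l : alpha <= 1 -> l != 0 ->
  (forall v, covolterra v + l *: v = 0 -> v = 0) /\
  exists2 M, 0 <= M &
    forall v, exists2 g, covolterra g + l *: g = v & `|g| <= M * `|v|.
Proof.
move=> a1 l0.
have mC x : measurable (~` `[0%R, x `^ alpha] : set (measurableTypeR R)).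
  exact: measurableC.
have /= := @kint_neumann _ _ p1 (fun x => ~` `[0%R, x `^ alpha]%classic) (@coclip01 R)
  mC _ (@measurable_coclip01 R) (@coclip01_01 R) _ (- l^-1) covolterra.
case.
- move=> g ig; rewrite (_ : (fun x => _) = (fun x => \int[mu]_y g y -
    \int[mu]_(y in `[0%R, x `^ alpha]) g y)).
    by apply: measurable_funB => //; exact: measurable_volterra.
  apply/funext => x.
  rewrite -[in RHS](setUv `[0%R, x `^ alpha]%classic).
  rewrite Rintegral_setU ?setUv//.
  - by rewrite addrC addKr.
  - by apply/disj_setPS => y [].
- move=> n x; rewrite int_coclip01 ?powR_ge0// ler_pM2r ?invr_gt0//.
  apply: lerXn2r; rewrite ?nnegrE.
  - by rewrite subr_ge0 ge_min lexx orbT.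
  - by case/andP: (coclip01_01 x).
  rewrite /coclip01; case: ifPn => [/andP[x0 x1]|_].
    rewrite lerB// le_min x1 andbT -[leLHS]powRr1//.
    by rewrite powR_anti// x0.
  by rewrite lerBlDr lerDl le_min powR_ge0 ler01.
- exact: covolterra_cls.
move=> inj [M M0 surj]; split; first exact: shift_inj.
exists (M * `|l^-1|); first exact: mulr_ge0.
exact: shift_surj.
Qed.

End quasinilpotent.

(** * Functions with a vanishing primitive *)

Section injectivity.
Context (R : realType).
Local Notation mu := (mu01 R).
Local Notation leb := (@lebesgue_measure R).
Local Notation C := R[i].

Lemma mu01_le (B : set (measurableTypeR R)) : measurable B -> (mu B <= leb B)%E.
Proof.
move=> mB; rewrite -[leLHS]/(leb (B `&` `[0%R, 1%R])).
by apply: le_measure; rewrite ?inE//; apply: measurableI.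
Qed.

Lemma ae_lebesgue_mu01 (P : set R) :
  {ae leb, forall x, P x} -> {ae mu, forall x, P x}.
Proof.
move=> [B [mB B0 PB]]; exists B; split => //.
by apply/eqP; rewrite eq_le measure_ge0 andbT -B0 mu01_le.
Qed.

Lemma ae_mu01_oo : {ae mu, forall x : R, 0 < x < 1}.
Proof.
exists (~` `]0%R, 1%R[); split.
- exact: measurableC.
- rewrite -[LHS]/(leb (~` `]0%R, 1%R[ `&` `[0%R, 1%R])).
  apply/eqP; rewrite eq_le measure_ge0 andbT.
  apply: (@le_trans _ _ (leb ([set 0%R] `|` [set 1%R]))).
    apply: le_measure; rewrite ?inE.
    + by apply: measurableI => //; exact: measurableC.
    + by apply: measurableU.
    + move=> x [/= h]; rewrite !in_itv/= => /andP[x0 x1].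
      move: h; rewrite in_itv/= => /negP; rewrite negb_and -!leNgt => /orP[h|h].
        by left; apply/eqP; rewrite eq_le h.
      by right; apply/eqP; rewrite eq_le x1.
  apply: (le_trans (measureU2 _ _ _)) => //.
  by rewrite -[X in (X + _)%E]/(leb _) -[X in (_ + X)%E]/(leb _) !lebesgue_measure_set1 adde0.
- by move=> x /= h; rewrite in_itv.
Qed.

(** A property that holds almost everywhere holds on a dense subset of ]0, 1[. *)
Lemma ae_mu01_exists (P : set R) (x e : R) : {ae mu, forall y, P y} ->
  0 < x < 1 -> 0 < e -> exists y, [/\ P y, 0 < y < 1 & `|x - y| < e].
Proof.
move=> aeP x01 e0; apply: contrapT => h.
have [B [mB B0 PB]] : {ae mu, forall y, P y /\ 0 < y < 1}.
  by apply: filterS2 aeP ae_mu01_oo => y.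
have /andP[x0 x1] := x01.
pose r := Num.min e (Num.min x (1 - x)).
have r0 : 0 < r by rewrite !lt_min e0 x0 subr_gt0.
have sub : ball x r `<=` B `&` `[0%R, 1%R].
  move=> y; rewrite -ball_normE /= => xy; split.
    apply: PB => /= -[Py y01]; apply: h; exists y; split => //.
    by rewrite (lt_le_trans xy)// ge_min lexx.
  have := xy; rewrite !lt_min => /and3P[_]; rewrite !ltr_norml => /andP[_ a] /andP[b _].
  by rewrite in_itv/=; apply/andP; split; lra.
have : (leb (ball x r) <= 0)%E.
  rewrite -B0 -[leRHS]/(leb (B `&` `[0%R, 1%R])).
  apply: le_measure => //; rewrite ?inE; first exact: measurable_ball.
  exact: measurableI.
rewrite (lebesgue_measure_ball _ (ltW r0)) lee_fin leNgt => /negP; apply.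
by rewrite pmulrn_lgt0.
Qed.

(** The primitive is continuous, so that it vanishes on ]0, 1[ as soon as it does
    at almost all points [x ^ alpha]; by Lebesgue's differentiation theorem its
    derivative is almost everywhere [g]. *)
Lemma primitive01_eq0 (g : measurableTypeR R -> R) (alpha : R) : 0 < alpha ->
  mu.-integrable setT (EFin \o g) ->
  {ae mu, forall x : R, \int[mu]_(y in `[0, x `^ alpha]) g y = 0} ->
  g = (fun=> 0) %[ae mu].
Proof.
move=> a0 ig gE.
have i01 : leb.-integrable `[0, 1] (EFin \o g).
  have /integrableP[mg] := integrableS measurableT (@measurable_itv01 R) (@subsetT _ _) ig.
  rewrite mu01_lebesgue// => gl; exact/integrableP.
pose f := g \_ `[0, 1].
have fi : leb.-integrable setT (EFin \o f).
  rewrite /f -restrict_EFin; exact: (integrable_mkcond _ _).1.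
pose F (x : R) := \int[leb]_(t in `[0, x]) f t.
have FE (x : R) : F x = \int[mu]_(y in `[0, x]) g y.
  by rewrite mu01_restrict// Rintegral_mkcondr.
have cF : {within `[0, 1], continuous F}.
  apply: (@parameterized_integral_continuous _ 0 1) => //; exact: integrableS fi.
have F0 (x : R) : 0 < x < 1 -> F x = 0.
  move=> x01; apply: contrapT => /eqP Fx0.
  have /andP[x0 x1] := x01.
  pose z := x `^ alpha^-1.
  have z01 : 0 < z < 1.
    rewrite powR_gt0//=.
    have : x `^ alpha^-1 < 1 `^ alpha^-1.
      by apply: gt0_ltr_powR => //; rewrite ?nnegrE ?invr_gt0// ltW.
    by rewrite powR1.
  have zx : z `^ alpha = x by rewrite -powRrM mulVf ?gt_eqF// powRr1// ltW.
  clearbody z.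
  have cFz : F (y `^ alpha) @[y --> z] --> F x.
    apply: (@cvg_comp _ _ _ (fun y : R => y `^ alpha) F _ (nbhs x)).
      have /andP[z0 _] := z01.
      suff : {for z, continuous (fun y : R => y `^ alpha)}.
        by move=> h; rewrite -[X in _ `=>` nbhs X]zx; exact: h.
      apply: differentiable_continuous; apply/derivable1_diffP.
      by apply: derivable_powR; rewrite in_itv/= z0.
    have [+ _ _] := (continuous_within_itvP _ (@ltr01 R)).1 cF.
    by apply; rewrite in_itv.
  have : \forall y \near z, F (y `^ alpha) != 0 by exact: cvgr_neq0 cFz Fx0.
  move=> /nbhs_ballP[e /= e0 he].
  have [y [Fy y01 yz]] := ae_mu01_exists gE z01 e0.
  have /negP := he y (ltac:(by rewrite -ball_normE)).
  by apply; rewrite FE Fy.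
have lf : locally_integrable [set: R] f by exact: integrable_locally i01.
have fiy y : leb.-integrable [set` Interval (BLeft 0) (BRight y)] (EFin \o f).
  by apply: integrableS fi.
have /= FTC := FTC1 fiy lf.
apply: filterS2 (ae_lebesgue_mu01 FTC) ae_mu01_oo => x h x01 _.
have /andP[x0 x1] := x01.
have [] := h; first by rewrite lte_fin.
move=> _; rewrite /f patchE mem_set; last by rewrite /= in_itv/= !ltW.
move=> <-; rewrite derive1E; transitivity ('D_1 (cst (0 : R)) x); last exact: derive_cst.
apply: near_eq_derive.
have /= : x \in `]0, 1[ by rewrite in_itv.
move=> /near_in_itvoo; apply: filterS => y; rewrite in_itv/= => y01; exact: (F0 y y01).
Qed.

End injectivity.

(** * The spectral value 0, and the spectrum when alpha is at least 1 *)

Lemma resolvent_eigen0 (K : numFieldType) (V : normedModType K)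
  (A : {linear V -> V}) (l : K) (v : V) : resolvent_set A l -> A v = l *: v -> v = 0.
Proof. by move=> [S [_ SK _]] Av; rewrite -(SK v) Av subrr linear0. Qed.

Section at_zero.
Context (R : realType) (p : R) (p1 : 1 <= p) (alpha : R).
Hypothesis alpha0 : 0 < alpha.
Local Notation C := R[i].
Local Notation mu := (mu01 R).
Local Notation LP := (cLspace mu p1).
Local Notation T := (volterra alpha p1).

Lemma volterra_inj (v : LP) : T v = 0 -> v = 0.
Proof.
rewrite -(cls_fun v); move: (cLspace_fun_cLfun v).
move: (cLspace_fun v) => f fL; have [fr fi] := cLfun_int p1 fL.
have vL : volterra_fun alpha f \in cLfun mu p := volterra_cLfun alpha (CLfun p1 fL).
rewrite volterra_cls// -(cls0 p1) => /cls_eq h.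
have {h}h := h vL (cLfun0 p1).
apply/cls_eq => //; first exact: cLfun0.
have fr0 : (fun x => complex.Re (f x)) = (fun=> 0) %[ae mu].
  apply: (primitive01_eq0 alpha0 fr); apply: (filterS _ h) => x /(_ I) fx.
  by have := congr1 (@complex.Re R) fx.
have fi0 : (fun x => complex.Im (f x)) = (fun=> 0) %[ae mu].
  apply: (primitive01_eq0 alpha0 fi); apply: (filterS _ h) => x /(_ I) fx.
  by have := congr1 (@complex.Im R) fx.
apply: (filterS2 _ _ fr0 fi0) => x a b _.
by apply/eqP; rewrite eq_complex a// b// eqxx.
Qed.

Lemma cRintegral_real (D : set R) (g : R -> R) :
  cRintegral mu D (fun x => (g x)%:C) = (\int[mu]_(x in D) g x)%:C.
Proof.
rewrite /cRintegral /=; congr (_ +i* _).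
by rewrite /Rintegral integral0_eq.
Qed.

Lemma normc_real (r : R) : normc r%:C = `|r|.
Proof. by rewrite /= expr0n/= addr0 sqrtr_sqr. Qed.

Lemma real_cLfun (g : R -> R) (M : R) :
  measurable_fun (setT : set (measurableTypeR R)) g -> (forall x, `|g x| <= M) ->
  (fun x => (g x)%:C) \in cLfun mu p.
Proof.
move=> mg gM; apply: (@cLfun_bounded _ _ p1 _ M).
  by split => //=; exact: measurable_cst.
by move=> x; rewrite normc_real.
Qed.

(** On [0, 1], [T] maps [x ^ n] to [x ^ (alpha (n + 1)) / (n + 1)], which is at most
    [x ^ n / (n + 1)]: the monomials are approximate eigenvectors at 0. *)
Lemma volterra_ge1_not_resolvent0 : 1 <= alpha -> ~ resolvent_set T 0.
Proof.
move=> a1.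
pose f n (x : R) : C := (clip01 x ^+ n)%:C.
have fL n : f n \in cLfun mu p.
  apply: (@real_cLfun _ 1); first by apply: measurable_funX; exact: measurable_clip01.
  by move=> x; have /andP[a b] := clip01_01 x; rewrite ger0_norm ?exprn_ge0// exprn_ile1.
apply: (@not_resolvent0 _ _ T (fun n => cls p1 (f n)) (fun n => n.+1%:R^-1)).
- move=> n; apply/eqP; rewrite -(cls0 p1) => /cls_eq h.
  have {h}h := h (fL n) (cLfun0 p1).
  have h' : {ae mu, forall x : R, f n x = 0} by apply: (filterS _ h) => x; apply.
  have [y [fy /andP[y0 y1] _]] := ae_mu01_exists h' (x := 2^-1) (e := 1)
     (ltac:(apply/andP; split; lra)) ltr01.
  have /eqP := congr1 (@complex.Re R) fy.
  by rewrite /= /clip01 !ltW// expf_eq0 gt_eqF// andbF.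
- move=> n; rewrite [X in `|X|]volterra_cls//.
  have vL : volterra_fun alpha (f n) \in cLfun mu p := volterra_cLfun alpha (CLfun p1 (fL n)).
  have nE : n.+1%:R^-1 = (n.+1%:R^-1 : R)%:C :> C by rewrite fmorphV rmorph_nat.
  have -> : n.+1%:R^-1 * `|cls p1 (f n)| = `|cls p1 (fun x => n.+1%:R^-1 * f n x)|.
    by rewrite clsZ// normrZ ger0_norm// invr_ge0 ler0n.
  have nfL : (fun x => n.+1%:R^-1 * f n x) \in cLfun mu p by exact: cLfunZ.
  rewrite !norm_cls// lecR; apply: Lpnorm_le => // x.
  rewrite /volterra_fun cRintegral_real nE -rmorphM !normc_real.
  rewrite int_clip01 ?powR_ge0//.
  have /andP[w0 w1] := clip01_01 x.
  have m0 : 0 <= Num.min (x `^ alpha) 1 by rewrite le_min powR_ge0 ler01.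
  rewrite !ger0_norm ?divr_ge0 ?mulr_ge0 ?exprn_ge0// mulrC ler_pM2l ?invr_gt0//.
  apply: (@le_trans _ _ (clip01 x ^+ n.+1)); last by rewrite exprS ler_piMl// exprn_ge0.
  by apply: lerXn2r; rewrite ?nnegrE// min_pow_clip01.
- move=> e e0; have [e1 e2] : 0 < complex.Re e /\ complex.Im e = 0.
    by move: e0; rewrite ltcE/= => /andP[/eqP-> ->].
  have [n hn] : exists n, (n.+1%:R^-1 : R) < complex.Re e.
    exists (Num.truncn (complex.Re e)^-1).
    rewrite invf_plt ?posrE ?ltr0Sn//.
    by rewrite truncnS_gt.
  exists n; case: e e0 e1 e2 hn => a b /= _ _ -> hn.
  by rewrite -(rmorph_nat (real_complex R)) -fmorphV ltcR.
Qed.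

Theorem volterra_ge1_spectrum : 1 <= alpha ->
  spectrum T = [set 0] /\ point_spectrum T = set0.
Proof.
move=> a1; split.
- apply/seteqP; split => l.
    by move=> h; apply: contrapT => /eqP l0; apply: h; exact: volterra_ge1_resolvent.
  by move=> ->; exact: volterra_ge1_not_resolvent0.
- apply/seteqP; split => // l [v /negP v0 Tv]; apply: v0; apply/eqP.
  have [l0|l0] := eqVneq l 0.
    by apply: volterra_inj; rewrite Tv l0 scale0r.
  exact: (resolvent_eigen0 (volterra_ge1_resolvent p1 a1 l0) Tv).
Qed.

End at_zero.

(** * Products of a power and a polynomial in the logarithm *)

Section powlog.
Context (R : realType).
Local Notation mu := (mu01 R).
Local Notation leb := (@lebesgue_measure R).
Implicit Types (q r : {poly R}) (g x t : R).

Definition powlog g q x : R := x `^ g * q.[ln x].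

(** Cut off outside [0, 1] so as to be bounded on the whole line. At 0 the factor
    [x `^ g] is 0 when [g != 0], whatever the value of [ln 0]. *)
Definition powlog01 g q x : R := if 0 <= x <= 1 then powlog g q x else 0.

(** One factor [l] of the polynomial is absorbed at a time by half of the
    exponential, as [1 + y <= exp y]. *)
Lemma poly_expR_bounded q g : 0 < g ->
  exists M, forall l, l <= 0 -> `|q.[l]| * expR (g * l) <= M.
Proof.
move: g; elim/poly_ind: q => [g _|q c IH g g0].
  by exists 0 => l _; rewrite horner0 normr0 mul0r.
have g20 : 0 < g / 2 by rewrite divr_gt0.
have [M HM] := IH _ g20.
exists (M * (2 / g) + `|c|) => l l0.
have e1 : expR (g * l) <= 1 by rewrite -expR0 ler_expR mulr_ge0_le0// ltW.
rewrite hornerMXaddC.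
apply: (@le_trans _ _ ((`|q.[l] * l| + `|c|) * expR (g * l))).
  by rewrite ler_wpM2r ?expR_ge0// ler_normD.
rewrite mulrDl; apply: lerD; last by rewrite ler_piMr.
have -> : expR (g * l) = expR (g / 2 * l) * expR (g / 2 * l).
  by rewrite -expRD; congr expR; field.
rewrite normrM mulrACA; apply: ler_pM; [by rewrite mulr_ge0 ?expR_ge0|by rewrite mulr_ge0 ?expR_ge0|exact: HM|].
rewrite ler0_norm// -[g / 2 * l]opprK expRN ler_pdivrMr ?expR_gt0//.
have := expR_ge1Dx (- (g / 2 * l)).
rewrite -(ler_pM2l (_ : 0 < 2 / g)) ?divr_gt0// => /(le_trans _); apply.
rewrite mulrDr mulr1 -mulrN; have -> : 2 / g * (g / 2 * - l) = - l.
  by field; rewrite gt_eqF.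
by rewrite lerDr divr_ge0// ltW.
Qed.

Lemma powlog_bounded q g : 0 < g ->
  exists M, forall x, 0 <= x <= 1 -> `|powlog g q x| <= M.
Proof.
move=> g0; have [M HM] := poly_expR_bounded q g0; exists M => x /andP[x0 x1].
have M0 : 0 <= M by apply: le_trans (HM 0 (lexx _)); rewrite mulr_ge0 ?expR_ge0.
rewrite /powlog normrM ger0_norm ?powR_ge0// /powR; case: ifPn => [/eqP xE|xn0].
  by rewrite gt_eqF// mul0r.
by rewrite mulrC HM// ln_le0.
Qed.

Lemma powlogS g h q x : 0 <= x -> 0 < g -> 0 < h ->
  powlog (g + h) q x = x `^ h * powlog g q x.
Proof.
move=> x0 g0 h0; rewrite /powlog powRD; first by rewrite mulrA [_ `^ g * _]mulrC.
by rewrite gt_eqF// addr_gt0.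
Qed.

Lemma powlog_cvg0 q g : 0 < g -> powlog g q x @[x --> 0^'+] --> 0.
Proof.
move=> g0; have g20 : 0 < g / 2 by rewrite divr_gt0.
have [M HM] := powlog_bounded q g20.
have M1 : 0 < `|M| + 1 by rewrite ltr_wpDl.
apply/cvgr0Pnorm_le => e e0.
have eM : 0 < e / (`|M| + 1) by rewrite divr_gt0.
near=> x.
have x0 : 0 < x by near: x; exact: nbhs_right_gt.
have x1 : x <= 1 by near: x; exact: nbhs_right_ltW.
(* Chosen so that [x `^ (g / 2)] is at most [e / (|M| + 1)]. *)
have xe : x <= (e / (`|M| + 1)) `^ (g / 2)^-1.
  by near: x; apply: nbhs_right_ltW; rewrite powR_gt0.
rewrite (_ : g = g / 2 + g / 2); last by field.
rewrite (powlogS _ (ltW x0) g20 g20) normrM ger0_norm ?powR_ge0//.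
rewrite -[leRHS](divfK (lt0r_neq0 M1)); apply: ler_pM => //; first exact: powR_ge0.
  have -> : e / (`|M| + 1) = ((e / (`|M| + 1)) `^ (g / 2)^-1) `^ (g / 2).
    by rewrite -powRrM mulVf ?gt_eqF// powRr1// ltW.
  by apply: ge0_ler_powR; rewrite ?nnegrE ?powR_ge0 ?(ltW g20) ?(ltW x0).
apply: (@le_trans _ _ M); first by apply: HM; rewrite x1 ltW.
by rewrite (le_trans (ler_norm M))// lerDl.
Unshelve. all: by end_near.
Qed.

Lemma powlog_continuous q g x : 0 < x -> {for x, continuous (powlog g q)}.
Proof.
move=> x0; apply: (@continuousM _ _ (fun y => y `^ g) (fun y => q.[ln y])).
  apply: differentiable_continuous; apply/derivable1_diffP.
  by apply: derivable_powR; rewrite in_itv/= x0.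
apply: (@continuous_comp _ _ _ (@ln R) (horner q)); last exact: continuous_poly.
exact: continuous_ln.
Qed.

Lemma powlog_derive r g x : 0 < x ->
  is_derive x 1 (powlog (g + 1) r) (powlog g ((g + 1) *: r + r^`()) x).
Proof.
move=> x0.
have d1 := is_derive1_powR (g + 1) x0.
have d2 := is_derive1_comp (is_derive_poly r (ln x)) (is_derive1_ln x0).
have h := is_deriveM d1 d2; apply: (is_derive_eq h).
rewrite addrK /powlog powRD; last by rewrite (gt_eqF x0) implybT.
rewrite powRr1 ?ltW// !hornerE -[_ *: _]/(_ * _) -[X in _ + X = _]/(_ * _) /=.
by field; rewrite gt_eqF.
Qed.

(** The primitive is [x ^ (g + 1) r(ln x)], with derivative
    [x ^ g ((g + 1) r + r')(ln x)]. All functions are continuous up to 0, where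
    they vanish, because [g > 0]. *)
Lemma powlog_FTC r g t : 0 < g -> 0 <= t ->
  \int[leb]_(x in `[0, t]) powlog g ((g + 1) *: r + r^`()) x = powlog (g + 1) r t.
Proof.
move=> g0; have g10 : 0 < g + 1 by rewrite addr_gt0.
have pl0 h q : 0 < h -> powlog h q 0 = 0.
  by move=> h0; rewrite /powlog powR0 ?mul0r// gt_eqF.
rewrite le_eqVlt => /predU1P[<-|t0]; first by rewrite set_itv1 Rintegral_set1 pl0.
rewrite /Rintegral (@continuous_FTC2 _ _ (powlog (g + 1) r))//.
- by rewrite /= pl0// subr0.
- apply/continuous_within_itvP => //; split.
  + by move=> x; rewrite in_itv/= => /andP[x0 _]; exact: powlog_continuous.
  + by rewrite pl0//; exact: powlog_cvg0.
  + by apply: cvg_at_left_filter; exact: powlog_continuous.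
- split.
  + by move=> x; rewrite in_itv/= => /andP[x0 _]; have := powlog_derive r g x0.
  + by rewrite pl0//; exact: powlog_cvg0.
  + by apply: cvg_at_left_filter; exact: powlog_continuous.
- move=> x; rewrite in_itv/= => /andP[x0 _]; rewrite derive1E.
  by have := powlog_derive r g x0 => h; rewrite derive_val.
Qed.

Lemma powlog01_bounded q g : 0 < g -> exists M, forall x, `|powlog01 g q x| <= M.
Proof.
move=> g0; have [M HM] := powlog_bounded q g0; exists `|M| => x.
rewrite /powlog01; case: ifPn => [/HM /le_trans|_]; last by rewrite normr0.
by apply; exact: ler_norm.
Qed.

Lemma measurable_powlog01 q g : measurable_fun (setT : set (measurableTypeR R)) (powlog01 g q).
Proof.
apply: measurable_fun_ifT => //.
- by apply: measurable_and; exact: measurable_fun_ler.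
- apply: measurable_funM; first exact: measurable_powR.
  apply: (@measurableT_comp _ _ _ _ _ _ (horner q)) => //.
  by apply: continuous_measurable_fun; exact: continuous_poly.
Qed.

Lemma int_powlog01 r g t : 0 < g -> 0 <= t <= 1 ->
  \int[mu]_(x in `[0, t]) powlog01 g ((g + 1) *: r + r^`()) x = powlog (g + 1) r t.
Proof.
move=> g0 /andP[t0 t1].
have [M HM] := powlog01_bounded ((g + 1) *: r + r^`()) g0.
rewrite mu01_restrict//; last first.
  by apply: (bounded_integrable01 (measurable_powlog01 _ _)).
rewrite -powlog_FTC//.
have -> : `[0, t]%classic `&` `[0, 1]%classic = `[0, t]%classic :> set R.
  apply/setIidl => y /=; rewrite !in_itv/= => /andP[-> /le_trans]; exact.
apply: eq_Rintegral => y; rewrite inE/= in_itv/= => /andP[y0 yt].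
by rewrite /powlog01 y0 (le_trans yt).
Qed.

End powlog.

(** * Eigenfunctions when alpha is less than 1 *)

Section eigenfunctions.
Context (R : realType) (alpha : R).
Hypothesis alpha0 : 0 < alpha.
Hypothesis alpha1 : alpha < 1.
Local Notation mu := (mu01 R).
Local Notation C := R[i].

Definition beta : R := alpha / (1 - alpha).

Definition eigval n : R := alpha ^+ n * (1 - alpha).

(** The equation [T f = eigval n *: f] for [f = x ^ beta P(ln x)] becomes, after
    integration, a first-order recursion on the coefficients of [P]. The factor
    [alpha ^ k / alpha ^ n - 1] vanishes for the first time at [k = n], which
    makes [P] a polynomial of degree [n]. *)
Fixpoint eigcoef n k : R :=
  if k is k'.+1 then beta * (alpha ^+ k' / alpha ^+ n - 1) * eigcoef n k' / k'.+1%:R else 1.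

Definition eigpoly n : {poly R} := \poly_(k < n.+1) eigcoef n k.

(** The polynomial such that [x ^ (beta + 1) eigprim(ln x)] is a primitive of
    [x ^ beta eigpoly(ln x)]. *)
Definition eigprim n : {poly R} := \poly_(k < n.+1) (eigval n * eigcoef n k / alpha ^+ k).

Let one_sub_alpha_neq0 : 1 - alpha != 0. Proof. by rewrite subr_eq0 gt_eqF. Qed.

Let alpha_neq0 : alpha != 0. Proof. by rewrite gt_eqF. Qed.

Let alphaX_neq0 n : alpha ^+ n != 0. Proof. by rewrite expf_neq0// alpha_neq0. Qed.

Lemma beta_gt0 : 0 < beta.
Proof. by rewrite divr_gt0// subr_gt0. Qed.

Lemma alphaM_beta1 : alpha * (beta + 1) = beta.
Proof. by rewrite /beta; field; exact: one_sub_alpha_neq0. Qed.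

Lemma eigcoef_eq0 n k : (n < k)%N -> eigcoef n k = 0.
Proof.
elim: k => // k IH; rewrite ltnS leq_eqVlt => /predU1P[->|/IH]/=.
  by rewrite divff ?alphaX_neq0// subrr mulr0 !mul0r.
by move=> ->; rewrite mulr0 mul0r.
Qed.

Lemma eigcoef_neq0 n k : (k <= n)%N -> eigcoef n k != 0.
Proof.
elim: k => [_|k IH kn]; first exact: oner_neq0.
have h : 1 < alpha ^+ k / alpha ^+ n.
  by rewrite ltr_pdivlMr ?exprn_gt0// mul1r ltr_iXn2l.
rewrite /= !mulf_neq0// ?IH ?(ltnW kn)//.
- by rewrite invr_eq0 one_sub_alpha_neq0.
- by rewrite subr_eq0 gt_eqF.
Qed.

Lemma size_eigpoly n : size (eigpoly n) = n.+1.
Proof. by rewrite size_poly_eq// eigcoef_neq0. Qed.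

Lemma coef_eigpoly n k : (eigpoly n)`_k = eigcoef n k.
Proof. by rewrite coef_poly; case: ltnP => // /eigcoef_eq0. Qed.

Lemma coef_eigprim n k : (eigprim n)`_k = eigval n * eigcoef n k / alpha ^+ k.
Proof. by rewrite coef_poly; case: ltnP => // /eigcoef_eq0 ->; rewrite mulr0 mul0r. Qed.

Lemma eigprimE n : (beta + 1) *: eigprim n + (eigprim n)^`() = eigpoly n.
Proof.
apply/polyP => k; rewrite coefD coefZ coef_deriv !coef_eigprim coef_eigpoly /=.
have k0 : 1 + k%:R != 0 :> R by rewrite nat1r pnatr_eq0.
rewrite -mulr_natr /eigval /beta exprS.
by field; rewrite k0 !alphaX_neq0 alpha_neq0 one_sub_alpha_neq0.
Qed.

(** Substituting [x ^ alpha] for [x] multiplies the logarithm by [alpha]. *)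
Lemma eigprim_horner n l : (eigprim n).[alpha * l] = eigval n * (eigpoly n).[l].
Proof.
rewrite !horner_poly mulr_sumr; apply: eq_bigr => k _.
by rewrite exprMn; field; exact: alphaX_neq0.
Qed.

Variables (p : R) (p1 : 1 <= p).
Local Notation LP := (cLspace mu p1).
Local Notation T := (volterra alpha p1).

Definition cpowlog (g : R) (q : {poly R}) (x : R) : C := (powlog01 g q x)%:C.

Lemma cpowlog_cLfun g q : 0 < g -> cpowlog g q \in cLfun mu p.
Proof.
move=> g0; have [M HM] := powlog01_bounded q g0.
by apply: (real_cLfun p1 _ HM); exact: measurable_powlog01.
Qed.

Definition eigfun n : LP := cls p1 (cpowlog beta (eigpoly n)).

Lemma eigfunE n : T (eigfun n) = (eigval n)%:C *: eigfun n.
Proof.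
have fL := cpowlog_cLfun (eigpoly n) beta_gt0.
have vL : volterra_fun alpha (cpowlog beta (eigpoly n)) \in cLfun mu p :=
  volterra_cLfun alpha (CLfun p1 fL).
rewrite volterra_cls// -clsZ//; apply/cls_eq => //; first exact: cLfunZ.
apply: (filterS _ (@ae_mu01_oo R)) => x /andP[x0 x1] _.
rewrite /volterra_fun cRintegral_real -rmorphM; congr (_%:C).
have xa : 0 <= x `^ alpha <= 1.
  rewrite powR_ge0/=.
  have : x `^ alpha <= 1 `^ alpha by apply: ge0_ler_powR; rewrite ?nnegrE ?ltW.
  by rewrite powR1.
rewrite -eigprimE int_powlog01 ?beta_gt0// eigprimE.
rewrite /powlog01 !ltW// /powlog ln_powR eigprim_horner -powRrM alphaM_beta1.
by rewrite mulrCA.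
Qed.

(** Otherwise [eigpoly n] would vanish at [ln x] for almost all, hence by
    continuity for all, [x] in ]0, 1[, in particular at -1, -2, -3 and so on. *)
Lemma eigfun_neq0 n : eigfun n != 0.
Proof.
have fL := cpowlog_cLfun (eigpoly n) beta_gt0.
apply/eqP; rewrite -(cls0 p1) => /cls_eq h.
have {h}h := h fL (cLfun0 p1).
have z (x : R) : 0 < x < 1 -> (eigpoly n).[ln x] = 0.
  move=> x01; apply: contrapT => /eqP nz.
  have /andP[x0 x1] := x01.
  have cP : {for x, continuous (fun y => (eigpoly n).[ln y])}.
    apply: (@continuous_comp _ _ _ (@ln R) (horner (eigpoly n))); last exact: continuous_poly.
    exact: continuous_ln.
  have : \forall y \near x, (eigpoly n).[ln y] != 0 by exact: cvgr_neq0 cP nz.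
  move=> /nbhs_ballP[e /= e0 he].
  have h' : {ae mu, forall x : R, cpowlog beta (eigpoly n) x = 0}.
    by apply: (filterS _ h) => y; apply.
  have [y [fy /andP[y0 y1] yx]] := ae_mu01_exists h' x01 e0.
  have /negP := he y (ltac:(by rewrite -ball_normE)); apply.
  have /eqP := congr1 (@complex.Re R) fy.
  by rewrite /= /powlog01 !ltW// mulf_eq0 gt_eqF ?powR_gt0.
have : eigpoly n = 0.
  apply: (@roots_geq_poly_eq0 _ _ [seq - (k.+1%:R) | k <- iota 0 n.+1]).
  - apply/allP => l /mapP[k _ ->]; apply/rootP.
    rewrite -[X in _.[X]]expRK z// expR_gt0/= expR_lt1 oppr_lt0 ltr0Sn//.
  - rewrite map_inj_uniq ?iota_uniq// => i j /oppr_inj/eqP.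
    by rewrite eqr_nat => /eqP[].
  - by rewrite size_map size_iota size_eigpoly.
by move/(congr1 (fun q : {poly R} => size q)); rewrite size_eigpoly size_poly0.
Qed.

End eigenfunctions.

(** * Approximation by a span, and dominated convergence *)

Section approximable.
Context (K : numFieldType) (V : normedModType K) (X : set V).
Implicit Types (F G : V).

(** Membership in the closed linear span of [X]. *)
Definition approximable F := forall e : K, 0 < e ->
  exists2 G, lin_span X G & `|F - G| < e.

Lemma lin_span_lin a F G : lin_span X F -> lin_span X G -> lin_span X (a *: F + G).
Proof.
move=> [n [b [x [Xx ->]]]] [m [c [y [Xy ->]]]].
exists (n + m)%N.
exists (fun i => match fintype.split i with inl j => a * b j | inr j => c j end).
exists (fun i => match fintype.split i with inl j => x j | inr j => y j end).
split; first by move=> i; case: fintype.split.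
rewrite big_split_ord/= scaler_sumr; congr (_ + _); apply: eq_bigr => i _.
- by rewrite (unsplitK (inl i)) scalerA.
- by rewrite (unsplitK (inr i)).
Qed.

Lemma approximable_span F : lin_span X F -> approximable F.
Proof. by move=> FX e e0; exists F => //; rewrite subrr normr0. Qed.

Lemma lin_span_mem F : X F -> lin_span X F.
Proof.
move=> XF; exists 1%N, (fun=> 1), (fun=> F); split => //.
by rewrite big_ord1 scale1r.
Qed.

Lemma approximable0 : approximable 0.
Proof.
apply: approximable_span; exists 0%N, (fun=> 0), (fun=> 0); split; first by case.
by rewrite big_ord0.
Qed.

Lemma approximable_lim F :
  (forall e : K, 0 < e -> exists2 G, approximable G & `|F - G| < e) -> approximable F.
Proof.
move=> h e e0; have e20 : 0 < e / 2 by rewrite divr_gt0.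
have [G GX FG] := h _ e20; have [H HX GH] := GX _ e20.
exists H => //; rewrite -(subrK G F) -addrA (le_lt_trans (ler_normD _ _))//.
by rewrite [ltRHS]splitr ltrD.
Qed.

Lemma approximable_lin a F G :
  approximable F -> approximable G -> approximable (a *: F + G).
Proof.
move=> FX GX e e0.
have a1 : 0 < `|a| + 1 by rewrite ltr_wpDl.
have e1 : 0 < e / 2 / (`|a| + 1) by rewrite !divr_gt0.
have e2 : 0 < e / 2 by rewrite divr_gt0.
have [F' F'X FF'] := FX _ e1; have [G' G'X GG'] := GX _ e2.
exists (a *: F' + G'); first exact: lin_span_lin.
rewrite opprD addrACA -scalerBr (le_lt_trans (ler_normD _ _))// normrZ.
rewrite [ltRHS]splitr; apply: ler_ltD => //.
apply: (@le_trans _ _ ((`|a| + 1) * (e / 2 / (`|a| + 1)))).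
  by apply: ler_pM => //; [rewrite lerDl|exact: ltW].
by rewrite mulrC divfK// lt0r_neq0.
Qed.

Lemma approximable_dense : (forall F, approximable F) -> dense (lin_span X).
Proof.
move=> h O [F OF] oO; have : nbhs F O by exact: open_nbhs_nbhs.
move=> /nbhs_ballP[e /= e0 eO]; have [G GX FG] := h F e e0.
by exists G; split => //; apply: eO; rewrite -ball_normE.
Qed.

End approximable.

Lemma powR_cvg0 (R : realType) (p : R) (a : R^nat) : 0 < p -> (forall n, 0 <= a n) ->
  a n @[n --> \oo] --> 0 -> a n `^ p @[n --> \oo] --> 0.
Proof.
move=> p0 a0 ca; apply/cvgr0Pnorm_le => e e0.
have e1 : 0 < e `^ p^-1 by rewrite powR_gt0.
have /cvgr0Pnorm_le/(_ _ e1) := ca; apply: filterS => n.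
rewrite !ger0_norm ?powR_ge0// => ane.
have -> : e = (e `^ p^-1) `^ p by rewrite -powRrM mulVf ?gt_eqF// powRr1// ltW.
by apply: ge0_ler_powR; rewrite ?nnegrE ?powR_ge0 ?(ltW p0).
Qed.

Section Lp_convergence.
Context (R : realType) (p : R) (p1 : 1 <= p).
Local Notation C := R[i].
Local Notation mu := (mu01 R).
Implicit Types u : measurableTypeR R -> R.

Definition rcls u : cLspace mu p1 := cls p1 (fun x => (u x)%:C).

Definition rLfun u := (fun x => (u x)%:C) \in cLfun mu p.

Lemma rLfun_le u g : measurable_fun setT u -> rLfun g ->
  (forall x, `|u x| <= `|g x|) -> rLfun u.
Proof.
move=> mu' /asboolP[mg fg] ug; have mcu : cmeasurable (fun x => (u x)%:C).
  by split=> //=; exact: measurable_cst.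
apply/asboolP; split=> //; apply: le_lt_trans fg; apply: Lnorm_le.
- exact: lt_le_trans p1.
- exact: measurable_normc.
- exact: measurable_normc.
- by move=> x; rewrite !ger0_norm ?normc_ge0// !normc_real.
Qed.

Lemma rLfun_measurable u : rLfun u -> measurable_fun setT u.
Proof. by move=> /asboolP[[]]. Qed.

Lemma rLfun_powR_integrable u : rLfun u ->
  mu.-integrable setT (EFin \o (fun x => `|u x| `^ p)).
Proof. by move=> /asboolP/(cLfunP _ p1)[uL _]; exact: Lfun_integrable. Qed.

Lemma rLfunB u v : rLfun u -> rLfun v -> rLfun (fun x => u x - v x).
Proof.
move=> uL vL; rewrite /rLfun (_ : (fun x => _) = (fun x => (u x)%:C - (v x)%:C)).
  exact: cLfunB.
by apply/funext => x; rewrite rmorphB.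
Qed.

Lemma rLfunZ a u : rLfun u -> rLfun (fun x => a * u x).
Proof.
move=> uL; rewrite /rLfun (_ : (fun x => _) = (fun x => a%:C * (u x)%:C)).
  exact: cLfunZ.
by apply/funext => x; rewrite rmorphM.
Qed.

Lemma rclsB u v : rLfun u -> rLfun v -> rcls u - rcls v = rcls (fun x => u x - v x).
Proof.
by move=> uL vL; rewrite /rcls -clsB//; congr cls; apply/funext => x; rewrite rmorphB.
Qed.

Lemma rcls_norm u : rLfun u ->
  (`|rcls u| = (Lpnorm mu p (fun x => (u x)%:C))%:C) /\
  ((Lpnorm mu p (fun x => (u x)%:C)) `^ p)%:E = (\int[mu]_x (`|u x| `^ p)%:E)%E.
Proof.
move=> uL; rewrite /rcls norm_cls//; split=> //.
rewrite -poweR_EFin (Lpnorm_fineK (CLfun p1 uL)) poweR_Lnorm; last first.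
  by rewrite gt_eqF// (lt_le_trans ltr01).
by apply: eq_integral => x _; rewrite -[LHS]/((`|normc (u x)%:C| `^ p)%:E)
  ger0_norm ?normc_ge0// normc_real.
Qed.

(** Dominated convergence for the p-th powers of the differences, which are at most
    [(2 |g|) ^ p]. *)
Lemma rcls_dct (u_ : (measurableTypeR R -> R)^nat) u (g : measurableTypeR R -> R) :
  (forall n, measurable_fun setT (u_ n)) -> measurable_fun setT u -> rLfun g ->
  (forall n x, `|u_ n x| <= `|g x|) -> (forall x, `|u x| <= `|g x|) ->
  {ae mu, forall x, u_ n x @[n --> \oo] --> u x} ->
  forall e : C, 0 < e -> exists n, `|rcls u - rcls (u_ n)| < e.
Proof.
move=> mu_ mu' gL ug_ ug cu [e e'] /=; rewrite ltcE/= => /andP[/eqP-> e0].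
have p0 : 0 < p := lt_le_trans ltr01 p1.
have uL : rLfun u by exact: rLfun_le ug.
have u_L n : rLfun (u_ n) by exact: rLfun_le (ug_ n).
have dL n : rLfun (fun x => u x - u_ n x) by exact: rLfunB.
pose D n x : \bar R := (`|u x - u_ n x| `^ p)%:E.
have mD n : measurable_fun setT (D n).
  by have /integrableP[] := rLfun_powR_integrable (dL n).
have g2L : rLfun (fun x => 2 * g x).
  exact: rLfunZ.
have := @dominated_convergence _ _ _ mu _ measurableT D (cst 0%E)
  (EFin \o (fun x => `|2 * g x| `^ p)) mD (measurable_cst _) _
  (rLfun_powR_integrable g2L).
case.
- apply: (filterS _ cu) => x ux _; rewrite /D.
  apply: cvg_EFin; first exact: nearW.
  apply: (powR_cvg0 p0) => [n|]; first exact: normr_ge0.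
  rewrite -(normr0 R) -(subrr (u x)); apply: cvg_norm; apply: cvgB => //.
  exact: cvg_cst.
- apply: aeW => x n _ /=; rewrite lee_fin ger0_norm ?powR_ge0//.
  apply: ge0_ler_powR; rewrite ?nnegrE ?(ltW p0)//.
  rewrite normrM ger0_norm// mulr2n mulrDl mul1r (le_trans (ler_normB _ _))//.
  by apply: lerD.
move=> _ _; rewrite integral0 => /fine_cvgP[fD].
move=> /cvgr0Pnorm_lt /(_ (e `^ p)); rewrite powR_gt0// => /(_ isT).
move=> eD.
have [n [fn en]] : exists n, (\int[mu]_x D n x)%E \is a fin_num /\
    `|fine (\int[mu]_x D n x)%E| < e `^ p.
  by have := filterI fD eD; move=> [n _ /(_ n (leqnn n))] /= h; exists n.
exists n; rewrite rclsB//; have [-> hE] := rcls_norm (dL n).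
rewrite ltcR.
have : (Lpnorm mu p (fun x => (u x - u_ n x)%:C)) `^ p < e `^ p.
  move: en; rewrite -[fine _]/(fine (\int[mu]_x (`|u x - u_ n x| `^ p)%:E)%E) -hE /=.
  by rewrite ger0_norm// powR_ge0.
rewrite ltNge => h; rewrite ltNge; apply: contra h => h.
by apply: ge0_ler_powR; rewrite ?nnegrE ?Lpnorm_ge0 ?(ltW p0) ?(ltW e0).
Qed.

End Lp_convergence.

(** * The closed span of the eigenfunctions contains weighted polynomials *)

Section span_closure.
Context (R : realType) (alpha : R).
Hypothesis alpha0 : 0 < alpha.
Hypothesis alpha1 : alpha < 1.
Variables (p : R) (p1 : 1 <= p).
Local Notation mu := (mu01 R).
Local Notation C := R[i].
Local Notation beta := (beta alpha).
Implicit Types u v : measurableTypeR R -> R.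

Definition eig_approx u :=
  rLfun p u /\ approximable (range (eigfun alpha p1)) (rcls p1 u).

Let beta0 : 0 < beta. Proof. exact: beta_gt0. Qed.

Lemma eig_approx_lin a u v : eig_approx u -> eig_approx v ->
  eig_approx (fun x => a * u x + v x).
Proof.
move=> [uL uX] [vL vX].
have E : (fun x => (a * u x + v x)%:C) = (fun x => a%:C * (u x)%:C + (v x)%:C).
  by apply/funext => x; rewrite rmorphD rmorphM.
split; first by rewrite /rLfun E; apply: (cLfunD p1) => //; exact: cLfunZ.
by rewrite /rcls E cls_lin//; exact: approximable_lin.
Qed.

Lemma eig_approx0 : eig_approx (fun=> 0).
Proof. by split; [exact: cLfun0|rewrite /rcls cls0; exact: approximable0]. Qed.

Lemma eig_approxZ a u : eig_approx u -> eig_approx (fun x => a * u x).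
Proof.
move=> uX; have := eig_approx_lin a uX eig_approx0.
by congr eig_approx; apply/funext => x; rewrite addr0.
Qed.

Lemma eig_approxD u v : eig_approx u -> eig_approx v -> eig_approx (fun x => u x + v x).
Proof.
move=> uX vX; have := eig_approx_lin 1 uX vX.
by congr eig_approx; apply/funext => x; rewrite mul1r.
Qed.

Lemma eig_approxB u v : eig_approx u -> eig_approx v -> eig_approx (fun x => u x - v x).
Proof.
move=> uX vX; have := eig_approx_lin (-1) vX uX.
by congr eig_approx; apply/funext => x; rewrite mulN1r addrC.
Qed.

Lemma eig_approx_sum (I : Type) (s : seq I) (u_ : I -> measurableTypeR R -> R) :
  (forall i, eig_approx (u_ i)) -> eig_approx (fun x => \sum_(i <- s) u_ i x).
Proof.
move=> uX; elim: s => [|i s IH].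
  by have := eig_approx0; congr eig_approx; apply/funext => x; rewrite big_nil.
have := eig_approxD (uX i) IH.
by congr eig_approx; apply/funext => x; rewrite big_cons.
Qed.

Lemma eig_approx_dct (u_ : (measurableTypeR R -> R)^nat) u (g : measurableTypeR R -> R) :
  (forall n, eig_approx (u_ n)) -> measurable_fun setT u -> rLfun p g ->
  (forall n x, `|u_ n x| <= `|g x|) -> (forall x, `|u x| <= `|g x|) ->
  {ae mu, forall x, u_ n x @[n --> \oo] --> u x} -> eig_approx u.
Proof.
move=> uX mu' gL ug_ ug cu; split; first exact: (rLfun_le p1 mu' gL ug).
apply: approximable_lim => e e0.
have mu_ n : measurable_fun setT (u_ n) by have [/rLfun_measurable] := uX n.
have [n hn] := rcls_dct p1 mu_ mu' gL ug_ ug cu e0.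
by exists (rcls p1 (u_ n)) => //; have [] := uX n.
Qed.

Lemma eig_approx_ae u v : eig_approx u -> rLfun p v -> {ae mu, forall x, u x = v x} ->
  eig_approx v.
Proof.
move=> [uL uX] vL uv; split => //; rewrite (_ : rcls p1 v = rcls p1 u)//.
by apply/esym/cls_eq => //; apply: (filterS _ uv) => x -> _.
Qed.

Lemma powlog01_lin g a (q r : {poly R}) x :
  powlog01 g (a *: q + r) x = a * powlog01 g q x + powlog01 g r x.
Proof.
rewrite /powlog01; case: ifP => _; last by rewrite mulr0 addr0.
by rewrite /powlog hornerD hornerZ mulrDr mulrCA.
Qed.

Lemma powlog01_rLfun g q : 0 < g -> rLfun p (powlog01 g q).
Proof. by move=> g0; exact: (cpowlog_cLfun p1). Qed.

(** The degrees of the polynomials [eigpoly n] are all the natural numbers, each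
    taken once, so that they span all polynomials. *)
Lemma eig_approx_poly (q : {poly R}) : eig_approx (powlog01 beta q).
Proof.
have [n] := ubnP (size q); elim: n q => // n IH q; rewrite ltnS => sq.
have [s0|] := posnP (size q).
  have -> : q = 0 by apply/eqP; rewrite -size_poly_eq0 s0.
  have := eig_approx0; congr eig_approx; apply/funext => x.
  by rewrite /powlog01 /powlog horner0 mulr0 if_same.
case: n IH sq => [|n] IH sq q0; first by move: (leq_trans q0 sq).
(* [c *: eigpoly n] has the same coefficient of degree [n] as [q]. *)
pose c := q`_n / eigcoef alpha n n.
have -> : q = c *: eigpoly alpha n + (q - c *: eigpoly alpha n) by rewrite addrC subrK.
have -> : powlog01 beta (c *: eigpoly alpha n + (q - c *: eigpoly alpha n)) =
  fun x => c * powlog01 beta (eigpoly alpha n) x + powlog01 beta (q - c *: eigpoly alpha n) x.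
  by apply/funext => x; exact: powlog01_lin.
apply: eig_approx_lin.
  split; first exact: powlog01_rLfun.
  by apply: approximable_span; apply: lin_span_mem; exists n.
apply: IH; rewrite ltnS; apply/leq_sizeP => j nj.
rewrite coefB coefZ coef_eigpoly//.
move: nj; rewrite leq_eqVlt => /predU1P[<-|nj].
  by rewrite divfK ?subrr// eigcoef_neq0.
by rewrite eigcoef_eq0// mulr0 subr0 nth_default// (leq_trans sq).
Qed.

Definition exp_poly (k : R) N : {poly R} := \poly_(i < N) (k ^+ i / i`!%:R).

Lemma horner_exp_poly k N l : (exp_poly k N).[l] = series (exp_coeff (k * l)) N.
Proof.
rewrite horner_poly /series /= big_mkord; apply: eq_bigr => i _.
by rewrite /exp_coeff/= exprMn mulrAC.
Qed.

Lemma exp_poly_le k N l : 0 <= k -> l <= 0 -> `|(exp_poly k N).[l]| <= expR (k * - l).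
Proof.
move=> k0 l0; rewrite horner_exp_poly.
have kl : 0 <= k * - l by rewrite mulr_ge0// oppr_ge0.
apply: (@le_trans _ _ (series (exp_coeff (k * - l)) N)).
  rewrite /series/=; apply: (le_trans (ler_norm_sum _ _ _)); apply: ler_sum => i _.
  rewrite /exp_coeff/= normrM normrX [`|k * l|]ler0_norm ?mulr_ge0_le0// mulrN.
  by rewrite ger0_norm ?invr_ge0.
apply: (@nondecreasing_cvgn_le _ (series (exp_coeff (k * - l)))); last exact: is_cvg_series_exp_coeff.
apply/nondecreasing_seqP => n; rewrite /series/= big_nat_recr//= lerDl.
exact: exp_coeff_ge0.
Qed.

(** Since [x ^ k = exp (k ln x)], the function [x ^ (g + k) q(ln x)] is the limit of
    [x ^ g q(ln x) E_N(ln x)], where [E_N] are the partial sums of the exponential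
    series. They are dominated by [x ^ (g - k) |q(ln x)|], which is bounded because
    [k < g]. *)
Lemma powlog01_exp_step g k : 0 < k -> k < g ->
  (forall q, eig_approx (powlog01 g q)) -> forall q, eig_approx (powlog01 (g + k) q).
Proof.
move=> k0 kg gX q; have g0 := lt_trans k0 kg.
have gk0 : 0 < g - k by rewrite subr_gt0.
have [M HM] := poly_expR_bounded q gk0.
have M0 : 0 <= M.
  by apply: le_trans (HM 0 (lexx _)); rewrite mulr_ge0 ?expR_ge0.
apply: (@eig_approx_dct (fun N => powlog01 g (q * exp_poly k N)) _ (fun=> M)).
- by move=> N; exact: gX.
- exact: measurable_powlog01.
- by apply: (@real_cLfun _ _ p1 _ `|M|) => //; exact: measurable_cst.
- move=> N x; rewrite (ger0_norm M0) /powlog01; case: ifP => [/andP[x0 x1]|_]; last by rewrite normr0.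
  rewrite /powlog /powR; case: ifPn => [_|xn0]; first by rewrite gt_eqF// mul0r normr0.
  have l0 : ln x <= 0 by exact: ln_le0.
  apply: le_trans (HM _ l0); rewrite hornerM !normrM (ger0_norm (expR_ge0 _)).
  rewrite mulrCA; apply: ler_wpM2l => //.
  apply: (@le_trans _ _ (expR (g * ln x) * expR (k * - ln x))).
    by rewrite ler_wpM2l ?expR_ge0// exp_poly_le// ltW.
  by rewrite -expRD mulrN mulrBl.
- move=> x; rewrite (ger0_norm M0) /powlog01; case: ifP => [/andP[x0 x1]|_]; last by rewrite normr0.
  rewrite /powlog /powR; case: ifPn => [_|xn0].
    by rewrite gt_eqF ?mul0r ?normr0// addr_gt0.
  have l0 : ln x <= 0 by exact: ln_le0.
  apply: le_trans (HM _ l0); rewrite normrM (ger0_norm (expR_ge0 _)) mulrC.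
  by apply: ler_wpM2l => //; rewrite ler_expR; nra.
- apply: aeW => x; rewrite /powlog01; case: ifP => [/andP[x0 x1]|_]; last exact: cvg_cst.
  rewrite /powlog; have [->|xn0] := eqVneq x 0.
    rewrite !powR0 ?gt_eqF ?addr_gt0// mul0r.
    by under eq_fun do rewrite mul0r; exact: cvg_cst.
  have -> : x `^ (g + k) * q.[ln x] = x `^ g * (q.[ln x] * expR (k * ln x)).
    rewrite powRD; last by rewrite xn0 implybT.
    by rewrite [X in _ * X * _]/powR (negPf xn0); ring.
  apply: cvgM; first exact: cvg_cst.
  under eq_fun do rewrite hornerM horner_exp_poly.
  by apply: cvgM; [exact: cvg_cst|exact: is_cvg_series_exp_coeff].
Qed.

Lemma eig_approx_steps k j q : 0 < k -> k < beta -> eig_approx (powlog01 (beta + k *+ j) q).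
Proof.
move=> k0 kb; elim: j q => [|j IH] q; first by rewrite mulr0n addr0; exact: eig_approx_poly.
rewrite mulrSr addrA; apply: powlog01_exp_step => //.
by rewrite (lt_le_trans kb)// lerDl mulrn_wge0// ltW.
Qed.

(** The increment [c] of the exponent is reached in [m] steps smaller than [beta]. *)
Lemma eig_approx_power c j : 0 < c -> eig_approx (powlog01 (beta + c *+ j) 1).
Proof.
move=> c0; pose m := (Num.truncn (c / beta)).+1.
have -> : c *+ j = (c / m%:R) *+ (m * j).
  by rewrite mulrnA -[X in _ = X *+ j]mulr_natr divfK ?pnatr_eq0.
apply: eig_approx_steps; first by rewrite divr_gt0.
by rewrite ltr_pdivrMr// mulrC -ltr_pdivrMr// truncnS_gt.
Qed.

Lemma eig_approx_horner c (r : {poly R}) : 0 < c ->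
  eig_approx (fun x => powlog01 beta 1 x * r.[x `^ c]).
Proof.
move=> c0.
have := @eig_approx_sum _ (index_enum 'I_(size r))
  (fun i x => r`_i * powlog01 (beta + c *+ i) 1 x) (fun i => eig_approxZ _ (eig_approx_power i c0)).
congr eig_approx; apply/funext => x; rewrite horner_coef mulr_sumr; apply: eq_bigr => i _.
rewrite /powlog01; case: ifP => [/andP[x0 x1]|_]; last by rewrite mulr0 mul0r.
rewrite /powlog hornerC !mulr1; have [->|xn0] := eqVneq x 0.
  rewrite powR0; last by rewrite gt_eqF// ltr_wpDr// mulrn_wge0// ltW.
  by rewrite powR0 ?gt_eqF// mulr0 mul0r.
rewrite powRD; last by rewrite xn0 implybT.
rewrite -powR_mulrn ?powR_ge0// -powRrM mulr_natr.
by rewrite mulrCA.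
Qed.

End span_closure.

(** * Density of the span of the eigenfunctions *)

Lemma bernoulli_le (R : realType) (u : R) m : 0 <= u <= 1 -> 1 - m%:R * u <= (1 - u) ^+ m.
Proof.
move=> /andP[u0 u1]; elim: m => [|m IH]; first by rewrite mul0r subr0 expr0.
rewrite exprS -natr1; apply: (@le_trans _ _ ((1 - u) * (1 - m%:R * u))).
  have : 0 <= m%:R * u * u by rewrite !mulr_ge0.
  nra.
by rewrite ler_wpM2l// subr_ge0.
Qed.

Lemma one_sub_pow_le (R : realType) (u : R) m : 0 <= u <= 1 ->
  (1 - u) ^+ m * (1 + m%:R * u) <= 1.
Proof.
move=> /andP[u0 u1].
have u10 : 0 <= 1 - u by rewrite subr_ge0.
elim: m => [|m IH]; first by rewrite expr0 mul0r addr0 mul1r.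
rewrite exprS -natr1; apply: le_trans IH.
rewrite [(1 - u) * _]mulrC -mulrA ler_wpM2l ?exprn_ge0//.
have : 0 <= m%:R * u * u by rewrite !mulr_ge0.
nra.
Qed.

Section threshold.
Context (R : realType).

(** On [0, 1] these polynomials tend to 1 on the left of 1/2 and to 0 on its right,
    because [2 ^ n * y ^ n] tends to 0 and to infinity respectively. *)
Definition threshold n : {poly R} := (1 - 'X^n) ^+ (2 ^ n).

Lemma horner_threshold n (y : R) : (threshold n).[y] = (1 - y ^+ n) ^+ (2 ^ n).
Proof. by rewrite /threshold horner_exp !hornerE. Qed.

Lemma threshold01 n (y : R) : 0 <= y <= 1 -> 0 <= (threshold n).[y] <= 1.
Proof.
move=> /andP[y0 y1]; rewrite horner_threshold.
have yn1 : y ^+ n <= 1 by rewrite exprn_ile1.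
by rewrite exprn_ge0 ?subr_ge0//= exprn_ile1 ?subr_ge0// gerBl exprn_ge0.
Qed.

Let natX n (y : R) : (2 ^ n)%:R * y ^+ n = (2 * y) ^+ n.
Proof. by rewrite natrX exprMn. Qed.

Lemma threshold_lt (y : R) : 0 <= y -> y < 2^-1 -> (threshold n).[y] @[n --> \oo] --> (1 : R).
Proof.
move=> y0 y2; have y1 : y <= 1 by lra.
have c0 : (2 * y) ^+ n @[n --> \oo] --> (0 : R).
  by apply: cvg_expr; rewrite ger0_norm ?mulr_ge0//; lra.
have c1 : 1 - (2 * y) ^+ n @[n --> \oo] --> (1 : R).
  by rewrite -[X in _ --> X]subr0; apply: cvgB => //; exact: cvg_cst.
apply: (squeeze_cvgr _ c1 (cvg_cst (1 : R))); apply: nearW => n.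
have /andP[_ ->] := threshold01 n (ltac:(by rewrite y0) : 0 <= y <= 1).
rewrite andbT horner_threshold -natX; apply: bernoulli_le.
by rewrite exprn_ge0// exprn_ile1.
Qed.

Lemma threshold_gt (y : R) : 2^-1 < y -> y <= 1 -> (threshold n).[y] @[n --> \oo] --> (0 : R).
Proof.
move=> y2 y1; have y0 : 0 < y by lra.
have c0 : ((2 * y)^-1) ^+ n @[n --> \oo] --> (0 : R).
  apply: cvg_expr; rewrite ger0_norm ?invr_ge0 ?mulr_ge0 ?ltW//.
  by rewrite invf_lt1//; lra.
apply: (squeeze_cvgr _ (cvg_cst (0 : R)) c0); apply: nearW => n.
have /andP[-> _] := threshold01 n (ltac:(by rewrite y1 ltW) : 0 <= y <= 1).
have yn : 0 <= y ^+ n <= 1 by rewrite exprn_ge0 ?(ltW y0)//= exprn_ile1 ?(ltW y0).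
have := one_sub_pow_le (2 ^ n) yn; rewrite natX -horner_threshold => h.
have z0 : 0 < (2 * y) ^+ n by rewrite exprn_gt0// mulr_gt0.
rewrite /= exprVn -[leRHS]mul1r ler_pdivlMr//; apply: le_trans h.
rewrite ler_wpM2l ?lerDr//.
by have /andP[] := threshold01 n (ltac:(by rewrite y1 ltW) : 0 <= y <= 1).
Qed.

End threshold.

Section density.
Context (R : realType) (alpha : R).
Hypothesis alpha0 : 0 < alpha.
Hypothesis alpha1 : alpha < 1.
Variables (p : R) (p1 : 1 <= p).
Local Notation mu := (mu01 R).
Local Notation leb := (@lebesgue_measure R).
Local Notation C := R[i].
Local Notation beta := (beta alpha).
Local Notation eig_approx := (eig_approx alpha p1).
Implicit Types u v : measurableTypeR R -> R.

Let beta0 : 0 < beta. Proof. exact: beta_gt0. Qed.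

Let W : measurableTypeR R -> R := powlog01 beta 1.

Let W_ge0 x : 0 <= W x.
Proof.
rewrite /W /powlog01; case: ifP => // _.
by rewrite /powlog hornerC mulr1 powR_ge0.
Qed.

Let W_out x : ~~ (0 <= x <= 1) -> W x = 0.
Proof. by rewrite /W /powlog01 => /negPf ->. Qed.

Let WL : rLfun p W. Proof. exact: powlog01_rLfun. Qed.

Let W_approx : eig_approx W. Proof. exact: eig_approx_poly. Qed.

Lemma ae_mu01_neq (a : R) : {ae mu, forall x : R, x != a}.
Proof.
apply: ae_lebesgue_mu01; exists [set a]; split => //.
  by rewrite -[LHS]/(leb _) lebesgue_measure_set1.
by move=> x /= /negP; rewrite negbK => /eqP.
Qed.

Let indicW_le (A : set R) x : `|W x * \1_A x| <= `|W x|.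
Proof. by rewrite normrM ler_piMr// indicE; case: (_ \in _); rewrite ?normr1 ?normr0. Qed.

Let mWindic (A : set (measurableTypeR R)) : measurable A ->
  measurable_fun setT (fun x => W x * \1_A x).
Proof.
move=> mA; apply: measurable_funM; first exact: measurable_powlog01.
exact: measurable_indic.
Qed.

Let WindicL (A : set (measurableTypeR R)) : measurable A -> rLfun p (fun x => W x * \1_A x).
Proof. by move=> mA; apply: (rLfun_le p1 (mWindic mA) WL) => x; exact: indicW_le. Qed.

(** The exponent [c] is chosen so that [a ^ c = 1/2]: the threshold of the
    polynomials in [x ^ c] is then located at [a]. *)
Lemma eig_approx_ray_lt a : 0 < a < 1 -> eig_approx (fun x => W x * \1_(`]-oo, a[) x).
Proof.
move=> /andP[a0 a1].
have lna : ln a < 0 by rewrite ln_lt0// a0.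
pose c := ln 2 / - ln a.
have c0 : 0 < c by rewrite divr_gt0 ?oppr_gt0// ln_gt0// ltr1n.
have ac : a `^ c = 2^-1.
  rewrite /powR gt_eqF// /c -[RHS](@lnK _ 2^-1) ?posrE ?invr_gt0//.
  by congr expR; rewrite lnV ?posrE//; field; rewrite lt_eqF.
have pow01 x : 0 <= x <= 1 -> 0 <= x `^ c <= 1.
  move=> /andP[x0 x1]; rewrite powR_ge0 /=.
  have : x `^ c <= 1 `^ c by apply: ge0_ler_powR; rewrite ?nnegrE ?(ltW c0).
  by rewrite powR1.
apply: (@eig_approx_dct _ _ p p1 (fun n x => W x * (threshold R n).[x `^ c]) _ W).
- by move=> n; exact: eig_approx_horner.
- exact: mWindic.
- exact: WL.
- move=> n x; have [x01|x01] := boolP (0 <= x <= 1); last by rewrite W_out// mul0r.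
  have /andP[t0 t1] := threshold01 n (pow01 x x01).
  by rewrite normrM ler_piMr// ger0_norm.
- exact: indicW_le.
apply: (filterS _ (ae_mu01_neq a)) => x xa.
have [x01|x01] := boolP (0 <= x <= 1); last first.
  by rewrite W_out// mul0r; under eq_fun do rewrite mul0r; exact: cvg_cst.
have /andP[x0 x1] := x01; have /andP[y0 y1] := pow01 x x01.
apply: cvgM; first exact: cvg_cst.
rewrite indicE; have [xlt|xgt|xE] := ltgtP x a; last by rewrite xE eqxx in xa.
- rewrite mem_set; last by rewrite /= in_itv.
  apply: threshold_lt => //; rewrite -ac.
  by apply: gt0_ltr_powR; rewrite ?nnegrE ?(ltW a0).
- rewrite memNset; last by rewrite /= in_itv/= ltNge ltW.
  apply: threshold_gt => //; rewrite -ac.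
  by apply: gt0_ltr_powR; rewrite ?nnegrE ?(ltW a0).
Qed.

Lemma eig_approx_ray a : eig_approx (fun x => W x * \1_(`]a, +oo[) x).
Proof.
have mI : measurable (`]a, +oo[%classic : set (measurableTypeR R)) by [].
have [a0|a0] := leP a 0.
  apply: (eig_approx_ae W_approx); first exact: WindicL.
  apply: (filterS _ (@ae_mu01_oo R)) => x /andP[x0 x1].
  by rewrite indicE mem_set ?mulr1// /= in_itv/= andbT (le_lt_trans a0).
have [a1|a1] := leP 1 a.
  apply: (eig_approx_ae (eig_approx0 _ p1)); first exact: WindicL.
  apply: (filterS _ (@ae_mu01_oo R)) => x /andP[x0 x1].
  rewrite indicE memNset ?mulr0// /= in_itv/= andbT ltNge => /negP; apply.
  by rewrite (le_trans (ltW x1)).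
have h := eig_approxB W_approx (eig_approx_ray_lt (ltac:(by rewrite a0) : 0 < a < 1)).
apply: (eig_approx_ae h); first exact: WindicL.
apply: (filterS _ (ae_mu01_neq a)) => x xa.
rewrite -[X in X - _]mulr1 -mulrBr; congr (_ * _); rewrite !indicE.
have [xlt|xgt|xE] := ltgtP x a; last by rewrite xE eqxx in xa.
- rewrite mem_set; last by rewrite /= in_itv.
  by rewrite memNset ?subrr// /= in_itv/= andbT ltNge ltW.
- rewrite memNset; last by rewrite /= in_itv/= ltNge ltW.
  by rewrite mem_set ?subr0// /= in_itv/= andbT.
Qed.

(** The sets whose weighted indicator is approximable form a lambda-system, which
    contains the pi-system of rays. *)
Lemma eig_approx_indic (A : set (measurableTypeR R)) : measurable A ->
  eig_approx (fun x => W x * \1_A x).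
Proof.
pose H := [set B : set (measurableTypeR R) | measurable B /\ eig_approx (fun x => W x * \1_B x)].
suff sub : <<s @RGenOInfty.G R >> `<=` H.
  move=> mA; have : (@RGenOInfty.G R).-sigma.-measurable A by rewrite -RGenOInfty.measurableE.
  by move=> /sub[].
apply: (@lambda_system_subset _ _ _ setT) => //.
- move=> _ _ [a ->] [b ->]; exists (Num.max a b).
  apply/seteqP; split=> x /=; rewrite !in_itv/= !andbT gt_max.
    by move=> [-> ->].
  by move=> /andP[].
- split => //.
  + split; first exact: measurableT.
    have := W_approx; congr eig_approx; apply/funext => x.
    by rewrite indicT mulr1.
  + move=> B D DB [mB BX] [mD DX]; split; first exact: measurableD.
    have := eig_approxB BX DX; congr eig_approx; apply/funext => x.
    rewrite -mulrBr; congr (_ * _).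
    rewrite !indicE; have [Dx|nDx] := pselect (D x).
      by rewrite (mem_set Dx) (mem_set (DB _ Dx)) memNset ?subrr//; case.
    rewrite (memNset nDx) subr0; have [Bx|nBx] := pselect (B x).
      by rewrite !mem_set.
    by rewrite !memNset//; case.
  + move=> F ndF FH; split; first by apply: bigcup_measurable => i _; case: (FH i).
    apply: (@eig_approx_dct _ _ p p1 (fun n x => W x * \1_(F n) x) _ W).
    * by move=> n; case: (FH n).
    * by apply: mWindic; apply: bigcup_measurable => i _; case: (FH i).
    * exact: WL.
    * by move=> n x; exact: indicW_le.
    * by move=> x; exact: indicW_le.
    * apply: aeW => x; apply: cvgM; first exact: cvg_cst.
      have [[k _ Fkx]|nF] := pselect ((\bigcup_i F i) x).
        apply: cvg_near_cst; exists k => // n /= kn.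
        rewrite !indicE !mem_set//; first by exists k.
        by have /subsetPset := ndF _ _ kn; exact.
      apply: cvg_near_cst; apply: nearW => n.
      by rewrite !indicE !memNset// => Fn; apply: nF; exists n.
- move=> _ [a ->]; split; first exact: measurable_itv.
  exact: eig_approx_ray.
Qed.

Import HBNNSimple.

Lemma eig_approx_simple (s : {nnsfun measurableTypeR R >-> R}) :
  eig_approx (fun x => W x * s x).
Proof.
pose t := finmap.enum_fset (fset_set (range s)).
have := @eig_approx_sum _ _ p p1 _ (index_enum 'I_(size t))
  (fun i x => t`_i * (W x * \1_(s @^-1` [set t`_i]) x))
  (fun i => eig_approxZ _ (eig_approx_indic (measurable_sfunP s (measurable_set1 _)))).
congr eig_approx; apply/funext => x.
rewrite (fimfunEord s x) mulr_sumr; apply: eq_bigr => i _.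
by rewrite mulrCA.
Qed.

(** The quotient of [u] by the weight is an increasing limit of simple functions;
    multiplied by the weight these stay below [u], so that domination by [u] holds
    although the quotient may be unbounded. *)
Lemma eig_approx_ge0 u : rLfun p u -> (forall x, 0 <= u x) -> eig_approx u.
Proof.
move=> uL u0; have mu' := rLfun_measurable uL.
(* The inverse of the weight on ]0, 1]. *)
pose V : measurableTypeR R -> R := powlog01 (- beta) 1.
have V0 x : 0 <= V x.
  by rewrite /V /powlog01; case: ifP => // _; rewrite /powlog hornerC mulr1 powR_ge0.
have WV x : 0 < x <= 1 -> W x * V x = 1.
  move=> /andP[x0 x1]; rewrite /W /V /powlog01 (ltW x0) x1 /powlog !hornerC !mulr1.
  by rewrite powRN divff// gt_eqF// powR_gt0.
have WVle x : W x * V x <= 1.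
  have [x01|] := boolP (0 <= x <= 1); last by move=> /W_out ->; rewrite mul0r.
  have /andP[] := x01; rewrite le_eqVlt => /predU1P[<- _|x0 x1].
    by rewrite /W /powlog01 lexx ler01 /powlog powR0 ?gt_eqF// !mul0r.
  by rewrite WV// x0.
pose f x := (u x * V x)%:E.
have mf : measurable_fun (setT : set (measurableTypeR R)) f.
  by apply/measurable_EFinP; apply: measurable_funM => //; exact: measurable_powlog01.
have f0 x : setT x -> (0 <= f x)%E by move=> _; rewrite lee_fin mulr_ge0.
pose s n := nnsfun_approx measurableT mf n.
have sf x : s n x @[n --> \oo] --> u x * V x.
  by have /fine_cvgP[_] := cvg_nnsfun_approx measurableT mf f0 (I : setT x).
have sle n x : s n x <= u x * V x.
  have nd : {homo (fun n => s n x) : n m / (n <= m)%N >-> n <= m}.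
    by move=> k m km; have /lefP := nd_nnsfun_approx measurableT mf km; exact.
  have := @nondecreasing_cvgn_le _ (fun n => s n x) nd (cvgP _ (sf x)) n.
  by rewrite (cvg_lim _ (sf x)).
have Ws n x : `|W x * s n x| <= `|u x|.
  rewrite !ger0_norm ?mulr_ge0//.
  apply: (le_trans (ler_wpM2l (W_ge0 x) (sle n x))).
  by rewrite mulrCA ler_piMr.
apply: (@eig_approx_dct _ _ p p1 (fun n x => W x * s n x) _ u) => //.
- by move=> n; exact: eig_approx_simple.
- apply: (filterS _ (@ae_mu01_oo R)) => x /andP[x0 x1].
  rewrite -[X in _ --> X]mulr1 -(WV x) ?x0 ?ltW// mulrCA.
  by apply: cvgM => //; exact: cvg_cst.
Qed.

Lemma eig_approx_all u : rLfun p u -> eig_approx u.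
Proof.
move=> uL; have mu' := rLfun_measurable uL.
have absL : rLfun p (fun x => `|u x|).
  apply: (rLfun_le p1 _ uL) => [|x]; last by rewrite normr_id.
  exact: measurableT_comp.
have h1 : eig_approx (fun x => `|u x|) by exact: eig_approx_ge0.
have h2 : eig_approx (fun x => `|u x| - u x).
  apply: eig_approx_ge0; first exact: rLfunB.
  by move=> x; rewrite subr_ge0 ler_norm.
have := eig_approxB h1 h2; congr eig_approx; apply/funext => x.
by rewrite opprB addrC subrK.
Qed.

Theorem dense_eigfun : dense (lin_span (range (eigfun alpha p1))).
Proof.
apply: approximable_dense => F; rewrite -(cls_fun F).
move: (cLspace_fun_cLfun F); move: (cLspace_fun F) => f fL.
have Lr u : u \in Lfun mu p%:E -> rLfun p u.
  by move=> uL; apply/asboolP/(cLfunP _ p1); split=> //; exact: (Lfun_cst mu 0).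
have /asboolP/(cLfunP _ p1)[/Lr reL /Lr imL] := fL.
have -> : f = (fun x => (0 +i* 1) * (complex.Im (f x))%:C + (complex.Re (f x))%:C).
  apply/funext => x; case: (f x) => a b; apply/eqP.
  by rewrite eq_complex /=; apply/andP; split; apply/eqP; ring.
rewrite cls_lin//; apply: approximable_lin.
- exact: (eig_approx_all imL).2.
- exact: (eig_approx_all reL).2.
Qed.

End density.

(** * The spectrum when alpha is less than 1 *)

Section subcritical.
Context (R : realType) (alpha : R).
Hypothesis alpha0 : 0 < alpha.
Hypothesis alpha1 : alpha < 1.
Variables (p : R) (p1 : 1 <= p).
Local Notation mu := (mu01 R).
Local Notation C := R[i].
Local Notation T := (volterra alpha p1).
Local Notation eigfun := (eigfun alpha p1).
Local Notation lam n := (eigval alpha n)%:C.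

Lemma eigval_neq0 n : lam n != 0 :> C.
Proof. by rewrite -(rmorph0 (real_complex R)) (inj_eq (@complexI R)) mulf_neq0// ?expf_neq0 ?gt_eqF// subr_gt0. Qed.

(** If [l] is none of the values [lam n], then every eigenfunction is in the range of
    [T - l], which is therefore dense, and [l] is not an eigenvalue. *)
Lemma volterra_lt1_resolvent (l : C) : l != 0 -> (forall n, l != lam n) -> resolvent_set T l.
Proof.
move=> l0 lE.
have [inj [M M0 surj]] := covolterra_shift p1 alpha0 (ltW alpha1) l0.
have [N N0 HN] := total_int_bounded p1.
apply: (rank_one_resolvent (@volterraE _ _ p1 alpha) surj HN) => //.
apply: (rank_one_dense_inj (@volterraE _ _ p1 alpha) inj surj HN
  (@dense_eigfun _ _ alpha0 alpha1 _ p1)) => // _ [n _ <-].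
have d0 : lam n - l != 0 by rewrite subr_eq0 eq_sym.
exists ((lam n - l)^-1 *: eigfun n).
suff h : T ((lam n - l)^-1 *: eigfun n) - l *: ((lam n - l)^-1 *: eigfun n) = eigfun n.
  exact: h.
by rewrite [T _]linearZ/= eigfunE// [l *: _]scalerA [l * _]mulrC -[(_ * l) *: _]scalerA
  -scalerBr -scalerBl scalerA mulVf// scale1r.
Qed.

Lemma eigenvector_proportional (n : nat) (v : cLspace mu p1) : T v = lam n *: v ->
  exists c, v = c *: eigfun n.
Proof.
move=> Tv.
have [inj [M M0 surj]] := covolterra_shift p1 alpha0 (ltW alpha1) (eigval_neq0 n).
have [E EP] := rank_one_eigenvectors (@volterraE _ _ p1 alpha) inj surj.
have [c vE] := EP v Tv; have [d fE] := EP _ (eigfunE alpha0 alpha1 p1 n).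
have d0 : d != 0.
  by apply: contraNneq (eigfun_neq0 alpha0 alpha1 p1 n) => d0; rewrite fE d0 scale0r.
by exists (c / d); rewrite fE scalerA divfK.
Qed.

Lemma eigenspaceE n : op_eigenspace T (lam n) = lin_span [set eigfun n].
Proof.
apply/seteqP; split=> v.
- move=> /eigenvector_proportional[c ->]; exists 1%N, (fun=> c), (fun=> eigfun n); split => //.
  by rewrite big_ord1.
- move=> [m [a [x [xE ->]]]].
  have h i : T (a i *: x i) = lam n *: (a i *: x i).
    have -> : x i = eigfun n by exact: xE.
    have Te := eigfunE alpha0 alpha1 p1 n.
    by rewrite [T _]linearZ/= [T _]Te !scalerA mulrC.
  rewrite /op_eigenspace /= linear_sum scaler_sumr.
  by apply: eq_bigr => i _; exact: h.
Qed.

(** The eigenvalues [lam n] accumulate at 0. *)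
Lemma volterra_lt1_not_resolvent0 : ~ resolvent_set T 0.
Proof.
apply: (@not_resolvent0 _ _ T eigfun (fun n => lam n)).
- exact: eigfun_neq0.
- move=> n; rewrite [X in `|X|]eigfunE// normrZ ger0_norm//.
  by rewrite lecR /eigval mulr_ge0 ?exprn_ge0 ?ltW// subr_gt0.
- move=> [e e'] /=; rewrite ltcE/= => /andP[/eqP-> e0].
  have c0 : eigval alpha n @[n --> \oo] --> (0 : R).
    rewrite -(mul0r (1 - alpha)); apply: cvgM; last exact: cvg_cst.
    by apply: cvg_expr; rewrite ger0_norm ?ltW.
  have /cvgr0Pnorm_lt/(_ _ e0)[n _ /(_ n (leqnn n))] := c0.
  move=> /(le_lt_trans (ler_norm _)) h.
  by exists n; rewrite ltcR.
Qed.

Lemma volterra_lt1_point_spectrum :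
  point_spectrum T = [set lam n | n in [set: nat]].
Proof.
apply/seteqP; split=> l.
- move=> [v v0 Tv]; apply: contrapT => nl.
  have l0 : l != 0.
    apply: contra_neq v0 => l0; apply: (volterra_inj alpha0).
    by rewrite Tv l0 scale0r.
  have lE n : l != lam n by apply/eqP => lE; apply: nl; exists n.
  by move/eqP: v0; apply; exact: (resolvent_eigen0 (volterra_lt1_resolvent l0 lE) Tv).
- by move=> [n _ <-]; exists (eigfun n); [exact: eigfun_neq0|exact: eigfunE].
Qed.

Lemma volterra_lt1_spectrum : spectrum T = point_spectrum T `|` [set 0].
Proof.
apply/seteqP; split=> l.
- move=> nr; have [->|l0] := eqVneq l 0; first by right.
  left; rewrite volterra_lt1_point_spectrum; apply: contrapT => nl.
  by apply: nr; apply: volterra_lt1_resolvent => // n; apply/eqP => lE; apply: nl; exists n.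
- move=> [[v v0 Tv] r|->]; last exact: volterra_lt1_not_resolvent0.
  by move/eqP: v0; apply; exact: (resolvent_eigen0 r Tv).
Qed.

Lemma eigfun_ae n : cLspace_fun (eigfun n) =
  (fun x : R => (x `^ (alpha / (1 - alpha)))%:C *
     (map_poly (real_complex R) (eigpoly alpha n)).[(ln x)%:C]) %[ae mu].
Proof.
have fL := cpowlog_cLfun p1 (eigpoly alpha n) (beta_gt0 alpha0 alpha1).
apply: (filterS2 _ _ (fun_cls p1 fL) (@ae_mu01_oo R)) => x fx /andP[x0 x1] _.
by rewrite (fx I) /cpowlog /powlog01 !ltW// /powlog rmorphM/= horner_map.
Qed.

End subcritical.

Theorem theorem3 (R : realType) (alpha : R) (alpha_gt0 : 0 < alpha) :
  (1 <= alpha ->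
    forall (p : R) (p_gt1 : 1 < p),
      spectrum (volterra alpha (ltW p_gt1)) = [set 0] /\
      point_spectrum (volterra alpha (ltW p_gt1)) = set0) /\
  (alpha < 1 ->
    exists P : nat -> {poly R[i]},
      (forall n : nat, size (P n) = n.+1) /\
      forall (p : R) (p_gt1 : 1 < p),
        [/\ spectrum (volterra alpha (ltW p_gt1)) =
              point_spectrum (volterra alpha (ltW p_gt1)) `|` [set 0],
            point_spectrum (volterra alpha (ltW p_gt1)) =
              [set (alpha ^+ n * (1 - alpha))%:C | n in [set: nat]] &
            exists f : nat -> cLspace (mu01 R) (ltW p_gt1),
              [/\ forall n : nat, cLspace_fun (f n) =
                    (fun x : R => (x `^ (alpha / (1 - alpha)))%:C *
                                  (P n).[(ln x)%:C]) %[ae mu01 R],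
                  forall n : nat,
                    op_eigenspace (volterra alpha (ltW p_gt1))
                      (alpha ^+ n * (1 - alpha))%:C = lin_span [set f n] &
                  dense (lin_span (range f))]]).
Proof.
split=> [a1 p p_gt1|a1]; first exact: volterra_ge1_spectrum.
exists (fun n => map_poly (real_complex R) (eigpoly alpha n)); split.
  by move=> n; rewrite size_map_poly size_eigpoly.
move=> p p_gt1; split.
- exact: volterra_lt1_spectrum.
- exact: volterra_lt1_point_spectrum.
- exists (eigfun alpha (ltW p_gt1)); split.
  + by move=> n; exact: eigfun_ae.
  + by move=> n; exact: eigenspaceE.
  + exact: dense_eigfun.
Qed.
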